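(* Let $f(z)=\sum_{n=0}^{\infty}a_nz^n$ and $g(z)=\sum_{n=0}^{\infty}b_nz^n$ be two analytic functions in $\mathbb{D}$. If $f(z)-f(0)\prec_q g(z)-g(0)$ in $\mathbb{D}$, then $$M_{f'}(r)\le M_{g'}(r)\qquad\text{for } 0\le r\le r_0=1-\sqrt{2/3}.$$ The radius $r_0$ cannot be improved: for every $R\in(r_0,1)$ there exist analytic functions $f,g$ in $\mathbb{D}$ with $f(z)-f(0)\prec_q g(z)-g(0)$ for which the inequality $M_{f'}(r)\le M_{g'}(r)$ fails for some $r\in(r_0,R]$.
   Context: $\mathbb{D}=\{z\in\mathbb{C}:|z|<1\}$. $\mathcal{B}$ is the class of analytic functions $\omega$ in $\mathbb{D}$ with $|\omega(z)|\le1$ for all $z\in\mathbb{D}$, and $\mathcal{B}_0=\{\omega\in\mathcal{B}:\omega(0)=0\}$. For analytic $F,G$ in $\mathbb{D}$, $F$ is quasi-subordinate to $G$, written $F\prec_qG$, if there exist $\Phi\in\mathcal{B}$ and $\omega\in\mathcal{B}_0$ such that $F(z)=\Phi(z)G(\omega(z))$ for $z\in\mathbb{D}$. For an analytic function $F(z)=\sum_{n=0}^{\infty}A_nz^n$ in $\mathbb{D}$, its majorant series is $M_F(r)=\sum_{n=0}^{\infty}|A_n|r^n$, $0\le r<1$; in particular $M_{f'}(r)=\sum_{n=1}^{\infty}n|a_n|r^{n-1}$. *)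

(* Defs.v *)
From Stdlib Require Import Reals.
From Coquelicot Require Import Coquelicot.

Open Scope R_scope.

Definition unit_disk (z : C) : Prop := Cmod z < 1.

(* [F : C -> C] is total; its values off the open set [U] play no role, since
   [eps] may be taken small enough for the disc about [z0] to lie in [U]. *)
Definition analytic_in (U : C -> Prop) (F : C -> C) : Prop :=
  forall z0 : C, U z0 ->
    exists (c : nat -> C) (eps : R), 0 < eps /\
      forall w : C, Cmod w < eps -> is_pseries c w (F (z0 + w)%C).

Definition taylor_in_disk (A : nat -> C) (F : C -> C) : Prop :=
  forall z : C, unit_disk z -> is_pseries A z (F z).

Definition class_B (w : C -> C) : Prop :=
  analytic_in unit_disk w /\ forall z : C, unit_disk z -> Cmod (w z) <= 1.

Definition class_B0 (w : C -> C) : Prop :=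
  class_B w /\ w (RtoC 0) = RtoC 0.

(* By the maximum principle [w] maps the disc into itself, so only values of
   [G] inside the disc are used. *)
Definition quasi_subordinate (F G : C -> C) : Prop :=
  exists Phi w : C -> C, class_B Phi /\ class_B0 w /\
    forall z : C, unit_disk z -> F z = (Phi z * G (w z))%C.

(* M_F(r) for F(z) = sum_n A_n z^n.  When the expansion is valid in the disc,
   the series converges for 0 <= r < 1, so the default value that [PSeries]
   gives to a divergent series does not occur there. *)
Definition majorant_series (A : nat -> C) (r : R) : R :=
  PSeries (fun n => Cmod (A n)) r.

(* Complex counterpart of Coquelicot's [PS_derive]. *)
Definition deriv_coeff (A : nat -> C) (n : nat) : C :=
  (RtoC (INR (S n)) * A (S n))%C.

Definition r0 : R := 1 - sqrt (2 / 3).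

(* Main.v *)
Require Import Defs.
From Stdlib Require Import Reals Lra Lia Classical ClassicalEpsilon.
From Coquelicot Require Import Coquelicot.

Open Scope R_scope.

(** Write [f - f(0) = Phi * (g(om) - g(0))] with [Phi] bounded by 1 and [om]
    a self-map of the disc fixing 0, and put [om z = z * psi z].  Schwarz's
    lemma gives [|psi| <= 1].  Comparing coefficients,
    [a_(i+1) = sum_(j <= i) b_(j+1) * e_j(i-j)], where [e_j] are the Taylor
    coefficients of [h_j = Phi * psi^(j+1)], a function bounded by 1
    ([subordinate_coeff]).  Such coefficients satisfy
    [|e_j(m)| <= 1 - |e_j(0)|^2] for [m >= 1] ([coeff_bound]).  After exchanging
    sums, the majorant inequality reduces, term by term in [j], to
    [sum_m (m+1) |e_j(m)| r^m <= 1] ([partial_majorant]).  With [p = |e_j(0)|]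
    the left side is at most [p + (1 - p^2) (1/(1-r)^2 - 1)], and
    [1/(1-r)^2 - 1 <= 1/2] is exactly [r <= 1 - sqrt (2/3)]; since
    [p + (1 - p^2)/2 <= 1], the claim follows ([bounded_coeff_sum]).

    The limiting case is [p -> 1], and this is where the extremal functions
    come from: [g z = z] and [f z = z (c - z)/(1 - c z)] with [c] close to 1
    ([sharpness]).

    The complex analysis is done without contour integrals.  A function that
    has a Taylor expansion to second order at every point satisfies the maximum
    principle ([max_principle]): at a maximum [z0] of [|F|^2 + delta |z|^2] in
    the interior, the sum of the values at the four points
    [z0 + t, z0 - t, z0 + it, z0 - it] exceeds four times the central value by
    at least [4 delta t^2 - O(t^3)].  Expansions with remainder O(w^n), called
    jets below, are stable under the algebraic operations and under division by
    powers of [z] and by nonvanishing functions, so local power series are all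
    that is needed of analyticity.  The bound [coeff_bound] follows from the maximum principle
    applied to [(H - c_0) / (z^m (1 - conj c_0 * H))], where [H] is the mean of
    [h] over rotations by the [m]-th roots of unity. *)

(** * Taylor expansions with remainder *)

Definition bigO (n : nat) (E : C -> C) : Prop :=
  exists K eps : R, 0 <= K /\ 0 < eps /\
    forall w : C, Cmod w < eps -> Cmod (E w) <= K * Cmod w ^ n.

Definition shift {T : Type} (c : nat -> T) (k : nat) : T := c (S k).

(** The first [n] terms, of degrees [0] to [n - 1].  The Horner form makes
    statements about products and divisions by [w] provable by induction on
    [n] with the coefficient sequence generalized. *)
Fixpoint poly (n : nat) (c : nat -> C) (w : C) : C :=
  match n with
  | O => RtoC 0
  | S m => (c O + w * poly m (shift c) w)%C
  end.

(** An expansion up to O(w^n): the coefficients [c k] with [k < n] matter.  In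
    particular [jet 3] is a second-order expansion. *)
Definition jet (n : nat) (F : C -> C) (z0 : C) (c : nat -> C) : Prop :=
  bigO n (fun w => F (z0 + w) - poly n c w)%C.

Fixpoint cauchy (c d : nat -> C) (k : nat) : C :=
  match k with
  | O => (c O * d O)%C
  | S j => (c O * d (S j) + cauchy (shift c) d j)%C
  end.

Lemma bigO_ext n E E' : (forall w, E w = E' w) -> bigO n E -> bigO n E'.
Proof.
  intros H (K & eps & HK & He & HE). exists K, eps. repeat split; auto.
  intros w Hw. rewrite <- H. auto.
Qed.

Lemma bigO_plus n E E' : bigO n E -> bigO n E' -> bigO n (fun w => E w + E' w)%C.
Proof.
  intros (K & eps & HK & He & HE) (K' & eps' & HK' & He' & HE').
  exists (K + K'), (Rmin eps eps'). repeat split; try lra.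
  - now apply Rmin_glb_lt.
  - intros w Hw.
    eapply Rle_trans; [apply Cmod_triangle|].
    pose proof (Rmin_l eps eps'). pose proof (Rmin_r eps eps').
    specialize (HE w ltac:(lra)). specialize (HE' w ltac:(lra)). lra.
Qed.

Lemma bigO_mult n m E E' :
  bigO n E -> bigO m E' -> bigO (n + m) (fun w => E w * E' w)%C.
Proof.
  intros (K & eps & HK & He & HE) (K' & eps' & HK' & He' & HE').
  exists (K * K'), (Rmin eps eps'). repeat split.
  - now apply Rmult_le_pos.
  - now apply Rmin_glb_lt.
  - intros w Hw. rewrite Cmod_mult, pow_add.
    pose proof (Rmin_l eps eps'). pose proof (Rmin_r eps eps').
    replace (K * K' * (Cmod w ^ n * Cmod w ^ m))
      with ((K * Cmod w ^ n) * (K' * Cmod w ^ m)) by ring.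
    apply Rmult_le_compat; try apply Cmod_ge_0; [apply HE|apply HE']; lra.
Qed.

Lemma bigO_const a : bigO 0 (fun _ => a).
Proof.
  exists (Cmod a), 1. repeat split; [apply Cmod_ge_0|lra|].
  intros. simpl. lra.
Qed.

Lemma bigO_id : bigO 1 (fun w => w).
Proof. exists 1, 1. repeat split; try lra. intros; simpl; lra. Qed.

Lemma bigO_pow n : bigO n (fun w => w ^ n)%C.
Proof.
  exists 1, 1. repeat split; try lra. intros. rewrite Cmod_pow. lra.
Qed.

Lemma bigO_zero n : bigO n (fun _ => RtoC 0).
Proof.
  exists 0, 1. repeat split; try lra. intros. rewrite Cmod_0. lra.
Qed.

Lemma bigO_weaken n m E : (m <= n)%nat -> bigO n E -> bigO m E.
Proof.
  intros Hnm (K & eps & HK & He & HE).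
  exists K, (Rmin eps 1). repeat split; auto.
  - apply Rmin_glb_lt; lra.
  - intros w Hw.
    pose proof (Rmin_l eps 1). pose proof (Rmin_r eps 1).
    pose proof (Cmod_ge_0 w).
    eapply Rle_trans; [apply HE; lra|].
    apply Rmult_le_compat_l; auto.
    replace n with (m + (n - m))%nat by lia. rewrite pow_add.
    rewrite <- (Rmult_1_r (Cmod w ^ m)) at 2.
    apply Rmult_le_compat_l; [now apply pow_le|].
    rewrite <- (pow1 (n - m)). apply pow_incr. lra.
Qed.

Lemma bigO_scal n a E : bigO n E -> bigO n (fun w => a * E w)%C.
Proof. intros H. exact (bigO_mult 0 n _ _ (bigO_const a) H). Qed.

Lemma bigO_opp n E : bigO n E -> bigO n (fun w => - E w)%C.
Proof.
  intros H. apply bigO_ext with (fun w => RtoC (-1) * E w)%C; [|now apply bigO_scal].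
  intros; ring.
Qed.

Lemma bigO_minus n E E' : bigO n E -> bigO n E' -> bigO n (fun w => E w - E' w)%C.
Proof. intros. apply bigO_plus; auto. now apply bigO_opp. Qed.

Lemma bigO_local n E E' eps :
  0 < eps -> (forall w, Cmod w < eps -> E w = E' w) -> bigO n E -> bigO n E'.
Proof.
  intros He H (K & e & HK & He0 & HE).
  exists K, (Rmin e eps). repeat split; auto.
  - now apply Rmin_glb_lt.
  - intros w Hw. pose proof (Rmin_l e eps). pose proof (Rmin_r e eps).
    rewrite <- H by lra. apply HE. lra.
Qed.

Lemma bigO_poly n c : bigO 0 (poly n c).
Proof.
  revert c; induction n as [|n IH]; intros c; simpl.
  - apply bigO_const.
  - apply bigO_plus; [apply bigO_const|].
    apply (bigO_weaken 1); [lia|]. exact (bigO_mult 1 0 _ _ bigO_id (IH _)).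
Qed.

Lemma poly_ext n c d w :
  (forall k, (k < n)%nat -> c k = d k) -> poly n c w = poly n d w.
Proof.
  revert c d; induction n as [|n IH]; intros c d H; simpl; auto.
  rewrite (H 0%nat) by lia. f_equal. f_equal. apply IH.
  intros k Hk. apply H. lia.
Qed.

Lemma poly_plus n c d w :
  poly n (fun k => c k + d k)%C w = (poly n c w + poly n d w)%C.
Proof.
  revert c d; induction n as [|n IH]; intros c d; simpl.
  - ring.
  - change (shift (fun k => c k + d k)%C) with (fun k => shift c k + shift d k)%C.
    rewrite IH. ring.
Qed.

Lemma poly_scal n a c w : poly n (fun k => a * c k)%C w = (a * poly n c w)%C.
Proof.
  revert c; induction n as [|n IH]; intros c; simpl.
  - ring.
  - change (shift (fun k => a * c k)%C) with (fun k => a * shift c k)%C.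
    rewrite IH. ring.
Qed.

Lemma poly_0 n w : poly n (fun _ => RtoC 0) w = RtoC 0.
Proof.
  induction n as [|n IH]; simpl; auto.
  change (shift (fun _ : nat => RtoC 0)) with (fun _ : nat => RtoC 0).
  rewrite IH. ring.
Qed.

Lemma poly_last n c w : poly (S n) c w = (poly n c w + c n * w ^ n)%C.
Proof.
  revert c; induction n as [|n IH]; intros c.
  - simpl. ring.
  - change (poly (S (S n)) c w) with (c O + w * poly (S n) (shift c) w)%C.
    rewrite IH. simpl. unfold shift. ring.
Qed.

(** Products of truncations agree with truncations of the product: peeling off
    the first coefficient of [c] leaves the same claim for [shift c], times
    [w], and one term of degree [n]. *)
Lemma poly_cauchy n c d :
  bigO n (fun w => poly n c w * poly n d w - poly n (cauchy c d) w)%C.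
Proof.
  revert c; induction n as [|n IH]; intros c.
  - apply bigO_ext with (fun _ => RtoC 0); [intros; simpl; ring|apply bigO_zero].
  - apply bigO_ext with (fun w =>
      w * (poly n (shift c) w * poly n d w - poly n (cauchy (shift c) d) w)
      + w ^ S n * (d n * poly n (shift c) w))%C.
    + intros w.
      replace (poly (S n) (cauchy c d) w)
        with (c O * poly (S n) d w + w * poly n (cauchy (shift c) d) w)%C.
      * replace (poly (S n) c w) with (c O + w * poly n (shift c) w)%C by reflexivity.
        rewrite poly_last. simpl Cpow. ring.
      * simpl.
        change (shift (cauchy c d))
          with (fun k => c O * shift d k + cauchy (shift c) d k)%C.
        rewrite poly_plus, poly_scal. ring.
    + apply bigO_plus.
      * exact (bigO_mult 1 n _ _ bigO_id (IH _)).
      * apply (bigO_weaken (S n + 0)); [lia|].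
        apply bigO_mult; [apply bigO_pow|].
        apply bigO_scal. apply bigO_poly.
Qed.

Lemma squeeze_zero (a : C) K eps :
  0 < eps -> (forall w, 0 < Cmod w < eps -> Cmod a <= K * Cmod w) -> a = RtoC 0.
Proof.
  intros He H. apply Cmod_eq_0.
  destruct (Rle_lt_dec (Cmod a) 0) as [Ha|Ha].
  - pose proof (Cmod_ge_0 a). lra.
  - exfalso.
    set (t := Rmin (eps / 2) (Cmod a / (2 * (Rabs K + 1)))).
    pose proof (Rabs_pos K). pose proof (Rle_abs K).
    assert (Ht : 0 < t).
    { apply Rmin_glb_lt; [lra|]. apply Rdiv_lt_0_compat; lra. }
    assert (Hm : Cmod (RtoC t) = t) by (rewrite Cmod_R; apply Rabs_pos_eq; lra).
    pose proof (Rmin_l (eps / 2) (Cmod a / (2 * (Rabs K + 1)))).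
    pose proof (Rmin_r (eps / 2) (Cmod a / (2 * (Rabs K + 1)))).
    fold t in H2, H3.
    assert (Ha' := H (RtoC t) ltac:(rewrite Hm; lra)). rewrite Hm in Ha'.
    assert (t * (2 * (Rabs K + 1)) <= Cmod a).
    { replace (Cmod a) with (Cmod a / (2 * (Rabs K + 1)) * (2 * (Rabs K + 1)))
        by (field; lra).
      apply Rmult_le_compat_r; lra. }
    nra.
Qed.

Lemma poly_bounded n c : exists K, 0 <= K /\
  forall w, Cmod w <= 1 -> Cmod (poly n c w) <= K.
Proof.
  revert c; induction n as [|n IH]; intros c; simpl.
  - exists 0. split; [lra|]. intros. rewrite Cmod_0. lra.
  - destruct (IH (shift c)) as (K & HK & H).
    exists (Cmod (c O) + K). pose proof (Cmod_ge_0 (c O)). split; [lra|].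
    intros w Hw. eapply Rle_trans; [apply Cmod_triangle|].
    rewrite Cmod_mult. specialize (H w Hw). pose proof (Cmod_ge_0 w).
    pose proof (Cmod_ge_0 (poly n (shift c) w)). nra.
Qed.

(** Uniqueness of expansions is proved on a punctured disc, since the induction
    divides by [w]. *)
Lemma poly_zero_punctured n c K eps :
  0 < eps ->
  (forall w, 0 < Cmod w < eps -> Cmod (poly n c w) <= K * Cmod w ^ n) ->
  forall k, (k < n)%nat -> c k = RtoC 0.
Proof.
  revert c K eps; induction n as [|n IH]; intros c K eps He H k Hk; [lia|].
  assert (H0 : c O = RtoC 0).
  { destruct (poly_bounded n (shift c)) as (K' & HK' & HP).
    apply (squeeze_zero _ (Rabs K + K') (Rmin eps 1)).
    - apply Rmin_glb_lt; lra.
    - intros w Hw. pose proof (Rmin_l eps 1). pose proof (Rmin_r eps 1).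
      specialize (H w ltac:(lra)). specialize (HP w ltac:(lra)).
      replace (c O) with (poly (S n) c w - w * poly n (shift c) w)%C
        by (simpl; ring).
      eapply Rle_trans; [apply Cmod_triangle|].
      rewrite Cmod_opp, Cmod_mult.
      assert (Cmod w ^ S n <= Cmod w).
      { assert (Cmod w ^ n <= 1)
          by (rewrite <- (pow1 n); apply pow_incr; lra).
        simpl. nra. }
      pose proof (Rle_abs K). pose proof (Rabs_pos K).
      assert (0 <= Cmod w ^ S n) by (apply pow_le; lra).
      assert (K * Cmod w ^ S n <= Rabs K * Cmod w) by nra.
      assert (Cmod w * Cmod (poly n (shift c) w) <= Cmod w * K')
        by (apply Rmult_le_compat_l; lra).
      lra. }
  destruct k as [|k]; auto.
  change (shift c k = RtoC 0).
  apply (IH (shift c) K eps); auto; [|lia].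
  intros w Hw. specialize (H w Hw). simpl in H. rewrite H0, Cplus_0_l, Cmod_mult in H.
  apply Rmult_le_reg_l with (Cmod w); [lra|].
  eapply Rle_trans; [exact H|]. right; ring.
Qed.

Lemma jet_unique n F z0 c d :
  jet n F z0 c -> jet n F z0 d -> forall k, (k < n)%nat -> c k = d k.
Proof.
  intros Hc Hd k Hk.
  assert (H : bigO n (poly n (fun k => c k + RtoC (-1) * d k)%C)).
  { apply bigO_ext with (2 := bigO_minus _ _ _ Hd Hc).
    intros w. rewrite poly_plus, poly_scal. ring. }
  destruct H as (K & eps & HK & He & H).
  assert (H' := poly_zero_punctured n _ K eps He ltac:(intros; apply H; lra) k Hk).
  simpl in H'.
  replace (c k) with ((c k + RtoC (-1) * d k) + d k)%C by ring.
  rewrite H'. ring.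
Qed.

Lemma jet_coeff_ext n F z0 c d :
  (forall k, (k < n)%nat -> c k = d k) -> jet n F z0 c -> jet n F z0 d.
Proof. intros H. apply bigO_ext. intros. now rewrite (poly_ext n c d). Qed.

Lemma jet_local n F G z0 c eps :
  0 < eps -> (forall w, Cmod w < eps -> F (z0 + w)%C = G (z0 + w)%C) ->
  jet n F z0 c -> jet n G z0 c.
Proof.
  intros He H. apply (bigO_local _ _ _ eps He). intros. now rewrite H.
Qed.

Lemma jet_weaken n m F z0 c : (m <= n)%nat -> jet n F z0 c -> jet m F z0 c.
Proof.
  intros Hnm. induction Hnm as [|n Hnm IH]; auto.
  intros H. apply IH. unfold jet in *.
  apply bigO_ext with
    (fun w => (F (z0 + w)%C - poly (S n) c w) + c n * w ^ n)%C.
  - intros. rewrite poly_last. ring.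
  - apply bigO_plus.
    + apply (bigO_weaken (S n)); auto.
    + apply bigO_scal, bigO_pow.
Qed.

Lemma jet_bounded n F z0 c : jet n F z0 c -> bigO 0 (fun w => F (z0 + w)%C).
Proof.
  intros H.
  apply bigO_ext with (fun w => (F (z0 + w) - poly n c w) + poly n c w)%C.
  - intros; ring.
  - apply bigO_plus; [|apply bigO_poly]. apply (bigO_weaken n); [lia|exact H].
Qed.

Lemma jet_plus n F G z0 c d :
  jet n F z0 c -> jet n G z0 d ->
  jet n (fun z => F z + G z)%C z0 (fun k => c k + d k)%C.
Proof.
  intros Hc Hd. apply bigO_ext with (2 := bigO_plus _ _ _ Hc Hd).
  intros w. rewrite poly_plus. ring.
Qed.

Lemma jet_scal n F z0 c a :
  jet n F z0 c -> jet n (fun z => a * F z)%C z0 (fun k => a * c k)%C.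
Proof.
  intros Hc. apply bigO_ext with (2 := bigO_scal _ a _ Hc).
  intros w. rewrite poly_scal. ring.
Qed.

Definition const_coeff (a : C) (k : nat) : C :=
  match k with O => a | S _ => RtoC 0 end.

Lemma jet_const n a z0 : jet n (fun _ => a) z0 (const_coeff a).
Proof.
  destruct n as [|n]; unfold jet.
  - apply bigO_minus; apply bigO_const.
  - apply bigO_ext with (fun _ => RtoC 0); [|apply bigO_zero].
    intros w. simpl. change (shift (const_coeff a)) with (fun _ : nat => RtoC 0).
    rewrite poly_0. ring.
Qed.

(** [F G - P Q = (F - P) G + P (G - Q)], and all factors are bounded near the
    base point. *)
Lemma jet_mult n F G z0 c d :
  jet n F z0 c -> jet n G z0 d ->
  jet n (fun z => F z * G z)%C z0 (cauchy c d).
Proof.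
  intros Hc Hd.
  apply bigO_ext with (fun w =>
    ((F (z0 + w) - poly n c w) * G (z0 + w)
     + poly n c w * (G (z0 + w) - poly n d w))
    + (poly n c w * poly n d w - poly n (cauchy c d) w))%C.
  - intros w. ring.
  - apply bigO_plus; [apply bigO_plus|apply poly_cauchy].
    + apply (bigO_weaken (n + 0)); [lia|]. apply bigO_mult; auto.
      apply (jet_bounded n _ _ d); auto.
    + apply (bigO_mult 0 n); auto. apply bigO_poly.
Qed.

Lemma jet_value n F z0 c : (0 < n)%nat -> jet n F z0 c -> F z0 = c O.
Proof.
  intros Hn (K & eps & HK & He & H).
  destruct n as [|n]; [lia|].
  assert (H0 := H (RtoC 0) ltac:(rewrite Cmod_0; lra)).
  rewrite Cmod_0, pow_i, Rmult_0_r in H0 by lia.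
  simpl in H0. rewrite Cplus_0_r, Cmult_0_l, Cplus_0_r in H0.
  assert (H1 : (F z0 - c O)%C = RtoC 0).
  { apply Cmod_eq_0. pose proof (Cmod_ge_0 (F z0 - c O)%C). lra. }
  replace (F z0) with ((F z0 - c O) + c O)%C by ring. rewrite H1. ring.
Qed.

Lemma jet_lipschitz n F z0 c : (0 < n)%nat -> jet n F z0 c ->
  exists K eps, 0 <= K /\ 0 < eps /\
    forall w, Cmod w < eps -> Cmod (F (z0 + w)%C - F z0)%C <= K * Cmod w.
Proof.
  intros Hn H. pose proof (jet_value _ _ _ _ Hn H) as H0.
  apply (jet_weaken n 1) in H; [|lia].
  destruct H as (K & eps & HK & He & H).
  exists K, eps. repeat split; auto. intros w Hw.
  specialize (H w Hw). simpl in H.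
  rewrite H0. rewrite Rmult_1_r in H.
  replace (F (z0 + w) - c O)%C with (F (z0 + w) - (c O + w * 0))%C by ring.
  exact H.
Qed.

Lemma jet_nonzero n F z0 c : (0 < n)%nat -> jet n F z0 c -> F z0 <> RtoC 0 ->
  exists eps, 0 < eps /\
    forall w, Cmod w < eps -> Cmod (F z0) / 2 <= Cmod (F (z0 + w)%C).
Proof.
  intros Hn H H0.
  destruct (jet_lipschitz _ _ _ _ Hn H) as (K & eps & HK & He & HL).
  apply Cmod_gt_0 in H0.
  exists (Rmin eps (Cmod (F z0) / (2 * (K + 1)))). split.
  { apply Rmin_glb_lt; auto. apply Rdiv_lt_0_compat; lra. }
  intros w Hw.
  pose proof (Rmin_l eps (Cmod (F z0) / (2 * (K + 1)))).
  pose proof (Rmin_r eps (Cmod (F z0) / (2 * (K + 1)))).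
  specialize (HL w ltac:(lra)).
  assert (Hw2 : Cmod w * (2 * (K + 1)) <= Cmod (F z0)).
  { replace (Cmod (F z0)) with (Cmod (F z0) / (2 * (K + 1)) * (2 * (K + 1)))
      by (field; lra).
    apply Rmult_le_compat_r; lra. }
  pose proof (Cmod_ge_0 w).
  assert (Cmod (F z0) <= Cmod (F (z0 + w)%C) + Cmod (F (z0 + w)%C - F z0)%C).
  { replace (F z0) with (F (z0 + w) + - (F (z0 + w) - F z0))%C at 1 by ring.
    eapply Rle_trans; [apply Cmod_triangle|]. rewrite Cmod_opp. lra. }
  nra.
Qed.

Lemma jet_poly n c z0 : jet n (fun z => poly n c (z - z0)%C) z0 c.
Proof.
  apply bigO_ext with (fun _ => RtoC 0); [|apply bigO_zero].
  intros w. replace (z0 + w - z0)%C with w by ring. ring.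
Qed.

(** The reciprocal power series [d] up to degree 2 is given explicitly; then
    [1/F - P_d = (1 - F P_d) / F], where the numerator is O(w^3) because
    [cauchy c d] is [1, 0, 0] and the denominator stays away from 0. *)
Lemma jet_inv F z0 c : jet 3 F z0 c -> F z0 <> RtoC 0 ->
  exists d, jet 3 (fun z => / F z)%C z0 d.
Proof.
  intros H H0.
  pose proof (jet_value 3 _ _ _ ltac:(lia) H) as Hc0.
  set (d0 := (/ c O)%C).
  set (d1 := (- c 1%nat * d0 * d0)%C).
  set (d2 := (- (c 1%nat * d1 + c 2%nat * d0) * d0)%C).
  set (d := fun k : nat => match k with O => d0 | 1%nat => d1 | _ => d2 end).
  exists d.
  assert (Hc : c O <> RtoC 0) by congruence.
  pose proof (jet_mult 3 _ _ _ _ _ H (jet_poly 3 d z0)) as Hm.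
  destruct (jet_nonzero 3 _ _ _ ltac:(lia) H H0) as (eps & He & Hlow).
  apply Cmod_gt_0 in H0.
  assert (Hi : bigO 0 (fun w => / F (z0 + w))%C).
  { exists (2 / Cmod (F z0)), eps. repeat split; auto.
    - apply Rlt_le, Rdiv_lt_0_compat; lra.
    - intros w Hw. specialize (Hlow w Hw). simpl. rewrite Rmult_1_r.
      rewrite Cmod_inv by (apply Cmod_gt_0; lra).
      replace (2 / Cmod (F z0)) with (/ (Cmod (F z0) / 2)) by (field; lra).
      apply Rinv_le_contravar; lra. }
  pose proof (bigO_mult _ _ _ _ (bigO_opp _ _ Hm) Hi) as Hp.
  unfold jet. apply (bigO_local 3 _ _ eps He) with (2 := Hp).
  intros w Hw. specialize (Hlow w Hw).
  assert (Hne : F (z0 + w)%C <> RtoC 0) by (apply Cmod_gt_0; lra).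
  replace (z0 + w - z0)%C with w by ring.
  assert (Hcd : poly 3 (cauchy c d) w = RtoC 1).
  { simpl. unfold shift, d. simpl. unfold shift, d2, d1, d0. field. auto. }
  rewrite Hcd. field. auto.
Qed.

Lemma poly_factor m n c w :
  (forall k, (k < m)%nat -> c k = RtoC 0) ->
  poly (m + n) c w = (w ^ m * poly n (fun k => c (m + k)%nat) w)%C.
Proof.
  revert c; induction m as [|m IH]; intros c H.
  - simpl. rewrite Cmult_1_l. apply poly_ext. auto.
  - simpl. rewrite H by lia. rewrite IH.
    + unfold shift. ring.
    + intros k Hk. apply H. lia.
Qed.

(** The quotient [F z / z^m] with its removable singularity at 0 filled in by
    the value [a]. *)
Definition div_pow (m : nat) (a : C) (F : C -> C) (z : C) : C :=
  if Ceq_dec z (RtoC 0) then a else (F z / z ^ m)%C.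

Lemma div_pow_nonzero m a F z : z <> RtoC 0 -> div_pow m a F z = (F z / z ^ m)%C.
Proof. intros Hz. unfold div_pow. now destruct (Ceq_dec z (RtoC 0)). Qed.

Lemma div_pow_zero m a F : div_pow m a F (RtoC 0) = a.
Proof. unfold div_pow. now destruct (Ceq_dec (RtoC 0) (RtoC 0)). Qed.

Lemma jet_div_pow m n F c : (0 < n)%nat ->
  (forall k, (k < m)%nat -> c k = RtoC 0) ->
  jet (m + n) F (RtoC 0) c ->
  jet n (div_pow m (c m) F) (RtoC 0) (fun k => c (m + k)%nat).
Proof.
  intros Hn Hc (K & eps & HK & He & H).
  exists K, eps. repeat split; auto. intros w Hw.
  specialize (H w Hw). rewrite Cplus_0_l in *.
  destruct (Req_EM_T (Cmod w) 0) as [Hw0|Hw0].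
  - apply Cmod_eq_0 in Hw0. subst w. rewrite div_pow_zero, Cmod_0, pow_i by lia.
    destruct n as [|n]; [lia|]. simpl.
    replace (m + 0)%nat with m by lia.
    replace (c m - (c m + 0 * _))%C with (RtoC 0) by ring.
    rewrite Cmod_0. lra.
  - assert (Hw1 : 0 < Cmod w) by (pose proof (Cmod_ge_0 w); lra).
    assert (Hne : w <> RtoC 0) by now apply Cmod_gt_0.
    rewrite div_pow_nonzero by auto.
    rewrite poly_factor in H by auto.
    apply Rmult_le_reg_l with (Cmod (w ^ m)).
    + rewrite Cmod_pow. now apply pow_lt.
    + rewrite <- Cmod_mult.
      replace (w ^ m * (F w / w ^ m - poly n (fun k => c (m + k)%nat) w))%C
        with (F w - w ^ m * poly n (fun k => c (m + k)%nat) w)%C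
        by (field; now apply Cpow_nz).
      eapply Rle_trans; [exact H|]. rewrite Cmod_pow, pow_add. right; ring.
Qed.

Lemma jet_mul_pow m n G c :
  jet n G (RtoC 0) c ->
  jet (m + n) (fun z => z ^ m * G z)%C (RtoC 0)
    (fun k => if (k <? m)%nat then RtoC 0 else c (k - m)%nat).
Proof.
  intros H.
  apply bigO_ext with (2 := bigO_mult m n _ _ (bigO_pow m) H).
  intros w. rewrite Cplus_0_l, poly_factor.
  - rewrite (poly_ext n (fun k => if (m + k <? m)%nat then RtoC 0 else c (m + k - m)%nat) c);
      [ring|].
    intros k _. destruct (Nat.ltb_spec (m + k) m); [lia|]. f_equal. lia.
  - intros k Hk. now destruct (Nat.ltb_spec k m); [|lia].
Qed.

Lemma is_series_C_eps (a : nat -> C) (l : C) (eps : R) :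
  is_series a l -> 0 < eps ->
  exists N, forall n, (N <= n)%nat -> Cmod (sum_n a n - l)%C < eps.
Proof.
  intros H He.
  destruct (H _ (locally_ball_norm l (mkposreal eps He))) as (N & HN).
  exists N. intros n Hn. exact (HN n Hn).
Qed.

Lemma sum_n_poly c w n :
  sum_n (fun k => scal (pow_n (K := C_AbsRing) w k) (c k)) n = poly (S n) c w.
Proof.
  assert (Hp : forall k, pow_n (K := C_AbsRing) w k = (w ^ k)%C).
  { induction k as [|k IH]; simpl; auto. }
  induction n as [|n IH].
  - rewrite sum_O; simpl; change (RtoC 1 * c O = c O + w * 0)%C; ring.
  - rewrite sum_Sn, IH, Hp, (poly_last (S n)).
    change (poly (S n) c w + w ^ S n * c (S n) = poly (S n) c w + c (S n) * w ^ S n)%C.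
    ring.
Qed.

Lemma pseries_coeff_bounded (c : nat -> C) (x : R) (l : C) :
  0 <= x -> is_pseries c (RtoC x) l ->
  exists M, 0 <= M /\ forall k, Cmod (c k) * x ^ k <= M.
Proof.
  intros Hx H.
  destruct (filterlim_bounded (K := C_AbsRing) (V := C_NormedModule) _
    (ex_intro _ l H)) as (M & HM).
  assert (HM' : forall n, Cmod (poly (S n) c (RtoC x)) <= M).
  { intros n. specialize (HM n). rewrite sum_n_poly in HM. exact HM. }
  assert (HM0 : 0 <= M) by (eapply Rle_trans; [apply Cmod_ge_0|apply (HM' O)]).
  exists (2 * M). split; [lra|]. intros k.
  assert (Hk : Cmod (poly k c (RtoC x)) <= M).
  { destruct k; [simpl; rewrite Cmod_0; lra|apply HM']. }
  specialize (HM' k). rewrite poly_last in HM'.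
  assert (E : Cmod (c k * RtoC x ^ k)%C = Cmod (c k) * x ^ k).
  { rewrite Cmod_mult, Cmod_pow, Cmod_R, Rabs_pos_eq; auto. }
  rewrite <- E.
  replace (c k * RtoC x ^ k)%C
    with ((poly k c (RtoC x) + c k * RtoC x ^ k) + - poly k c (RtoC x))%C by ring.
  eapply Rle_trans; [apply Cmod_triangle|]. rewrite Cmod_opp. lra.
Qed.

(** Comparison with a geometric series of ratio at most 1/2; the factor
    [2 - 2 (1/2)^j] is the partial sum of that series and makes the induction
    on [j] close. *)
Lemma poly_tail c M rho n w : 0 < rho -> 0 <= M ->
  (forall k, Cmod (c k) * rho ^ k <= M) -> Cmod w <= rho / 2 ->
  forall j, Cmod (poly (j + n) c w - poly n c w)%C
    <= M * (Cmod w / rho) ^ n * (2 - 2 * (1 / 2) ^ j).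
Proof.
  intros Hr HM Hc Hw.
  set (q := Cmod w / rho).
  assert (Hq : 0 <= q <= 1 / 2).
  { pose proof (Cmod_ge_0 w). unfold q. split.
    - apply Rmult_le_pos; [lra|]. apply Rlt_le, Rinv_0_lt_compat; lra.
    - apply Rmult_le_reg_r with rho; auto. unfold Rdiv.
      rewrite Rmult_assoc, Rinv_l by lra. lra. }
  assert (Hqn : 0 <= q ^ n) by (apply pow_le; lra).
  induction j as [|j IH].
  - simpl. replace (poly n c w - poly n c w)%C with (RtoC 0) by ring.
    rewrite Cmod_0. lra.
  - change (S j + n)%nat with (S (j + n)). rewrite poly_last.
    replace (poly (j + n) c w + c (j + n)%nat * w ^ (j + n) - poly n c w)%C
      with ((poly (j + n) c w - poly n c w) + c (j + n)%nat * w ^ (j + n))%C by ring.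
    eapply Rle_trans; [apply Cmod_triangle|].
    assert (Ht : Cmod (c (j + n)%nat * w ^ (j + n))%C <= M * q ^ n * (1 / 2) ^ j).
    { rewrite Cmod_mult, Cmod_pow.
      replace (Cmod w) with (rho * q) by (unfold q; field; lra).
      rewrite Rpow_mult_distr, <- Rmult_assoc.
      apply Rle_trans with (M * q ^ (j + n)).
      - apply Rmult_le_compat_r; auto. apply pow_le; lra.
      - rewrite pow_add. rewrite Rmult_assoc. apply Rmult_le_compat_l; auto.
        rewrite Rmult_comm. apply Rmult_le_compat_l; auto. apply pow_incr; lra. }
    simpl. nra.
Qed.

(** The bridge from power series to expansions with remainder: by
    [poly_tail] the partial sums beyond degree [n] stay within a constant times
    [|w|^n], and the bound passes to the limit. *)
Lemma pseries_jet F z0 c eps : 0 < eps ->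
  (forall w, Cmod w < eps -> is_pseries c w (F (z0 + w)%C)) ->
  forall n, jet n F z0 c.
Proof.
  intros He H n.
  set (rho := eps / 2).
  assert (Hr : 0 < rho) by (unfold rho; lra).
  destruct (pseries_coeff_bounded c rho (F (z0 + RtoC rho)%C)) as (M & HM & Hc).
  { lra. }
  { apply H. rewrite Cmod_R, Rabs_pos_eq; unfold rho; lra. }
  assert (Hrn : 0 < / rho ^ n) by (apply Rinv_0_lt_compat, pow_lt; auto).
  exists (2 * M * / rho ^ n), (rho / 2). repeat split.
  - apply Rmult_le_pos; lra.
  - lra.
  - intros w Hw.
    apply le_epsilon. intros e Hepos.
    destruct (is_series_C_eps _ _ e (H w ltac:(unfold rho in *; lra)) Hepos) as (N & HN).
    specialize (HN (N + n)%nat ltac:(lia)). rewrite sum_n_poly in HN.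
    pose proof (poly_tail c M rho n w Hr HM Hc ltac:(lra) (S N)) as Ht.
    replace (S N + n)%nat with (S (N + n)) in Ht by lia.
    replace (F (z0 + w) - poly n c w)%C
      with (- (poly (S (N + n)) c w - F (z0 + w)) + (poly (S (N + n)) c w - poly n c w))%C
      by ring.
    eapply Rle_trans; [apply Cmod_triangle|]. rewrite Cmod_opp.
    assert (M * (Cmod w / rho) ^ n * (2 - 2 * (1 / 2) ^ S N)
            <= 2 * M * / rho ^ n * Cmod w ^ n).
    { unfold Rdiv at 1. rewrite Rpow_mult_distr, pow_inv.
      assert (0 <= (1 / 2) ^ S N) by (apply pow_le; lra).
      assert (0 <= M * (Cmod w ^ n * / rho ^ n)).
      { apply Rmult_le_pos; auto. apply Rmult_le_pos; [|lra].
        apply pow_le, Cmod_ge_0. }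
      nra. }
    lra.
Qed.

(** * The maximum principle *)

(** Compactness of the closed disc.  The covering radius at a point is chosen
    below the inverse of the local bound there, so that a positive
    lower bound [d] for the radii gives the global bound [1/d] for [v]. *)
Lemma disk_locally_bounded (v : C -> R) (r : R) :
  (forall p, Cmod p <= r -> exists eps M, 0 < eps /\
     forall q, Cmod q <= r -> Cmod (q - p)%C < eps -> v q <= M) ->
  exists M, forall q, Cmod q <= r -> v q <= M.
Proof.
  intros H.
  assert (Hd : forall p : C, exists d : posreal,
    forall q, Cmod q <= r -> Cmod (q - p)%C < 2 * d -> v q <= / d).
  { intros p. destruct (Rle_lt_dec (Cmod p) r) as [Hp|Hp].
    - destruct (H p Hp) as (eps & M & He & HM).
      assert (HM0 : 0 < / (Rabs M + 1)).
      { apply Rinv_0_lt_compat. pose proof (Rabs_pos M). lra. }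
      assert (Hpos : 0 < Rmin (eps / 2) (/ (Rabs M + 1)))
        by (apply Rmin_glb_lt; lra).
      exists (mkposreal _ Hpos). simpl. intros q Hq Hqp.
      pose proof (Rmin_l (eps / 2) (/ (Rabs M + 1))).
      pose proof (Rmin_r (eps / 2) (/ (Rabs M + 1))).
      apply Rle_trans with (Rabs M + 1).
      + specialize (HM q Hq ltac:(lra)). pose proof (Rle_abs M). lra.
      + rewrite <- (Rinv_inv (Rabs M + 1)) at 1. now apply Rinv_le_contravar.
    - assert (Hpos : 0 < (Cmod p - r) / 2) by lra.
      exists (mkposreal _ Hpos). simpl. intros q Hq Hqp. exfalso.
      assert (Cmod p <= Cmod q + Cmod (q - p)%C).
      { replace p with (q + - (q - p))%C at 1 by ring.
        eapply Rle_trans; [apply Cmod_triangle|]. rewrite Cmod_opp. lra. }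
      lra. }
  set (delta := fun x y : R =>
    proj1_sig (constructive_indefinite_description _ (Hd (x, y)))).
  assert (Hdelta : forall x y q, Cmod q <= r ->
    Cmod (q - (x, y))%C < 2 * delta x y -> v q <= / delta x y).
  { intros x y. exact (proj2_sig (constructive_indefinite_description _ (Hd (x, y)))). }
  destruct (compactness_value_2d (- r) r (- r) r delta) as (d & Hcomp).
  exists (/ d). intros [x y] Hq.
  pose proof (Rmax_Cmod (x, y)) as Hm. simpl in Hm.
  pose proof (Rmax_l (Rabs x) (Rabs y)). pose proof (Rmax_r (Rabs x) (Rabs y)).
  assert (Hx : - r <= x <= r) by (apply Rabs_le_between; lra).
  assert (Hy : - r <= y <= r) by (apply Rabs_le_between; lra).
  destruct (NNPP _ (Hcomp x y Hx Hy)) as (a & b & _ & _ & Ha & Hb & Hle).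
  apply Rle_trans with (/ delta a b).
  - apply Hdelta; auto.
    replace ((x, y) - (a, b))%C with (RtoC (x - a) + Ci * RtoC (y - b))%C
      by (apply injective_projections; simpl; ring).
    eapply Rle_lt_trans; [apply Cmod_triangle|].
    rewrite Cmod_mult, Cmod_Ci, !Cmod_R. lra.
  - apply Rinv_le_contravar; auto. apply cond_pos.
Qed.

(** If the supremum [S] were not attained, [1/(S - v)] would be locally bounded,
    hence bounded, and [v] would stay below some number smaller than [S]. *)
Lemma disk_max (v : C -> R) (r : R) : 0 <= r ->
  (forall p, Cmod p <= r -> forall eta, 0 < eta -> exists eps, 0 < eps /\
     forall q, Cmod q <= r -> Cmod (q - p)%C < eps -> v q <= v p + eta) ->
  exists p, Cmod p <= r /\ forall q, Cmod q <= r -> v q <= v p.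
Proof.
  intros Hr Husc.
  destruct (disk_locally_bounded v r) as (M & HM).
  { intros p Hp. destruct (Husc p Hp 1 Rlt_0_1) as (eps & He & H).
    exists eps, (v p + 1). auto. }
  destruct (completeness (fun y => exists q, Cmod q <= r /\ y = v q)) as (S & HS1 & HS2).
  { exists M. intros y (q & Hq & ->). auto. }
  { exists (v (RtoC 0)), (RtoC 0). rewrite Cmod_0. auto. }
  apply NNPP. intros Hno.
  assert (Hlt : forall q, Cmod q <= r -> v q < S).
  { intros q Hq. destruct (Rle_lt_dec S (v q)) as [Hle|]; auto.
    exfalso. apply Hno. exists q. split; auto. intros q' Hq'.
    apply Rle_trans with S; auto. apply HS1. eauto. }
  destruct (disk_locally_bounded (fun q => / (S - v q)) r) as (M' & HM').
  { intros p Hp. specialize (Hlt p Hp).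
    destruct (Husc p Hp ((S - v p) / 2) ltac:(lra)) as (eps & He & H).
    exists eps, (/ ((S - v p) / 2)). split; auto.
    intros q Hq Hqp. specialize (H q Hq Hqp). apply Rinv_le_contravar; lra. }
  assert (HM0 : 0 < M').
  { eapply Rlt_le_trans; [|apply (HM' (RtoC 0)); rewrite Cmod_0; auto].
    apply Rinv_0_lt_compat. specialize (Hlt (RtoC 0)). rewrite Cmod_0 in Hlt.
    specialize (Hlt Hr). lra. }
  assert (S <= S - / M').
  { apply HS2. intros y (q & Hq & ->). specialize (HM' q Hq). specialize (Hlt q Hq).
    assert (/ M' <= S - v q).
    { rewrite <- (Rinv_inv (S - v q)). apply Rinv_le_contravar; auto.
      apply Rinv_0_lt_compat. lra. }
    lra. }
  assert (0 < / M') by now apply Rinv_0_lt_compat.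
  lra.
Qed.

(** Four times a discrete mean over the circle of radius [t].  Four points are
    enough to average out the terms of degree 1 and 2 of a real quadratic
    polynomial, except for its Laplacian. *)
Definition cross_sum (u : C -> R) (z0 : C) (t : R) : R :=
  u (z0 + RtoC t)%C + u (z0 + RtoC (- t))%C
  + u (z0 + Ci * RtoC t)%C + u (z0 + Ci * RtoC (- t))%C.

Lemma sq_lower a b e : 0 <= a -> 0 <= e -> a - e <= b -> 0 <= b -> a ^ 2 - 2 * a * e <= b ^ 2.
Proof. intros. destruct (Rle_lt_dec e a); nra. Qed.

(** Approximate subharmonicity of [|F|^2].  For the quadratic polynomial
    [P w = c0 + c1 w + c2 w^2] the four values of [|P|^2] add up exactly to
    [4 (|c0|^2 + |c1|^2 t^2 + |c2|^2 t^4)]; the remainder of the expansion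
    costs O(t^3). *)
Lemma jet_cross_sum F z0 c : jet 3 F z0 c ->
  exists K eps, 0 <= K /\ 0 < eps /\ forall t, 0 <= t < eps ->
    4 * Cmod (F z0) ^ 2 - K * t ^ 3 <= cross_sum (fun z => Cmod (F z) ^ 2) z0 t.
Proof.
  intros H. rewrite (jet_value 3 _ _ _ ltac:(lia) H).
  destruct H as (K & eps & HK & He & H).
  destruct (poly_bounded 3 c) as (L & HL & HP).
  exists (8 * L * K), (Rmin eps 1). repeat split.
  - apply Rmult_le_pos; lra.
  - apply Rmin_glb_lt; lra.
  - intros t Ht. pose proof (Rmin_l eps 1) as Hm1. pose proof (Rmin_r eps 1) as Hm2.
    assert (Hlow : forall w, Cmod w = t ->
      Cmod (poly 3 c w) ^ 2 - 2 * L * K * t ^ 3 <= Cmod (F (z0 + w)%C) ^ 2).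
    { intros w Hw. specialize (H w ltac:(lra)). specialize (HP w ltac:(lra)).
      rewrite Hw in H.
      pose proof (Cmod_ge_0 (poly 3 c w)).
      assert (0 <= t ^ 3) by (apply pow_le; lra).
      eapply Rle_trans; [|apply (sq_lower (Cmod (poly 3 c w)) _ (K * t ^ 3))]; auto.
      - assert (Cmod (poly 3 c w) * (K * t ^ 3) <= L * (K * t ^ 3)).
        { apply Rmult_le_compat_r; auto. now apply Rmult_le_pos. }
        lra.
      - now apply Rmult_le_pos.
      - assert (Cmod (poly 3 c w) <= Cmod (F (z0 + w)%C) + Cmod (F (z0 + w) - poly 3 c w)%C).
        { replace (poly 3 c w) with (F (z0 + w) + - (F (z0 + w) - poly 3 c w))%C at 1 by ring.
          eapply Rle_trans; [apply Cmod_triangle|]. rewrite Cmod_opp. lra. }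
        lra.
      - apply Cmod_ge_0. }
    assert (Ht1 : Cmod (RtoC t) = t) by (rewrite Cmod_R, Rabs_pos_eq; lra).
    assert (Ht2 : Cmod (RtoC (- t)) = t)
      by (rewrite Cmod_R, Rabs_Ropp, Rabs_pos_eq; lra).
    pose proof (Hlow _ Ht1) as H1. pose proof (Hlow _ Ht2) as H2.
    pose proof (Hlow (Ci * RtoC t)%C) as H3. pose proof (Hlow (Ci * RtoC (- t))%C) as H4.
    rewrite Cmod_mult, Cmod_Ci, Rmult_1_l in H3, H4.
    specialize (H3 Ht1). specialize (H4 Ht2).
    assert (Hid : 4 * Cmod (c O) ^ 2 <= cross_sum (fun z => Cmod (poly 3 c z) ^ 2) (RtoC 0) t).
    { unfold cross_sum. rewrite !Cplus_0_l, !Cmod2_alt.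
      destruct (c O) as [a0 b0] eqn:E0.
      destruct (c 1%nat) as [a1 b1] eqn:E1. destruct (c 2%nat) as [a2 b2] eqn:E2.
      simpl poly. unfold shift. rewrite E0, E1, E2. simpl.
      (* The cross terms cancel over the four points. *)
      match goal with |- ?l <= ?r =>
        replace r with (l + (4 * (a1 ^ 2 + b1 ^ 2) * t ^ 2 + 4 * (a2 ^ 2 + b2 ^ 2) * t ^ 4)) by ring
      end.
      assert (0 <= (a1 ^ 2 + b1 ^ 2) * t ^ 2) by (apply Rmult_le_pos; nra).
      assert (0 <= t ^ 4) by (apply pow_le; lra).
      assert (0 <= (a2 ^ 2 + b2 ^ 2) * t ^ 4) by (apply Rmult_le_pos; nra).
      lra. }
    unfold cross_sum in *. rewrite !Cplus_0_l in Hid. lra.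
Qed.

(** The term [delta |z|^2] turns the weak inequality of [jet_cross_sum] into a
    strict one: it contributes [4 delta t^2], which beats the error [K t^3] for
    small [t].  So the maximum of the sum over the closed disc lies on the
    circle; then [delta] tends to 0. *)
Lemma max_principle (F : C -> C) (r B : R) : 0 < r -> 0 <= B ->
  (forall z, Cmod z <= r -> exists c, jet 3 F z c) ->
  (forall z, Cmod z = r -> Cmod (F z) <= B) ->
  forall z, Cmod z <= r -> Cmod (F z) <= B.
Proof.
  intros Hr HB Hj Hbd z Hz.
  assert (Hdelta : forall delta, 0 < delta -> Cmod (F z) ^ 2 <= B ^ 2 + delta).
  { intros delta0 Hd0.
    (* The perturbation is normalized to equal [delta0] on the circle. *)
    set (delta := delta0 / r ^ 2).
    assert (Hr2 : 0 < r ^ 2) by now apply pow_lt.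
    assert (Hd : 0 < delta) by (unfold delta; apply Rdiv_lt_0_compat; auto).
    assert (Hdr : delta * r ^ 2 = delta0) by (unfold delta; field; lra).
    set (v := fun z => Cmod (F z) ^ 2 + delta * Cmod z ^ 2).
    (* Continuity of [v], from the first-order expansion of [F]. *)
    destruct (disk_max v r) as (p & Hp & Hmax); [lra| |].
    { intros p Hp eta Heta. destruct (Hj p Hp) as (c & Hc).
      destruct (jet_lipschitz 3 _ _ _ ltac:(lia) Hc) as (K & eps & HK & He & HL).
      set (a := Cmod (F p)). set (b := Cmod p).
      assert (Ha : 0 <= a) by apply Cmod_ge_0. assert (Hb : 0 <= b) by apply Cmod_ge_0.
      set (L := 2 * K * a + K ^ 2 + delta * (2 * b + 1)).
      assert (HL0 : 0 <= L) by (unfold L; nra).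
      exists (Rmin (Rmin eps 1) (eta / (L + 1))). split.
      { repeat apply Rmin_glb_lt; try lra. apply Rdiv_lt_0_compat; lra. }
      intros q Hq Hqp.
      pose proof (Rmin_l (Rmin eps 1) (eta / (L + 1))) as Hm1.
      pose proof (Rmin_r (Rmin eps 1) (eta / (L + 1))) as Hm2.
      pose proof (Rmin_l eps 1) as Hm3. pose proof (Rmin_r eps 1) as Hm4.
      set (d := Cmod (q - p)%C) in *.
      assert (Hd00 : 0 <= d) by apply Cmod_ge_0.
      specialize (HL (q - p)%C ltac:(fold d; lra)). fold d in HL.
      replace (p + (q - p))%C with q in HL by ring.
      assert (H1 : Cmod (F q) <= a + K * d).
      { replace (F q) with (F p + (F q - F p))%C by ring.
        eapply Rle_trans; [apply Cmod_triangle|]. fold a. lra. }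
      assert (H2 : Cmod q <= b + d).
      { replace q with (p + (q - p))%C at 1 by ring. apply Cmod_triangle. }
      assert (Hdl : d * (L + 1) <= eta).
      { replace eta with (eta / (L + 1) * (L + 1)) by (field; lra).
        apply Rmult_le_compat_r; lra. }
      assert (H3 : Cmod (F q) ^ 2 <= (a + K * d) ^ 2)
        by (apply pow_incr; split; [apply Cmod_ge_0|auto]).
      assert (H4 : Cmod q ^ 2 <= (b + d) ^ 2)
        by (apply pow_incr; split; [apply Cmod_ge_0|auto]).
      assert (H5 : (b + d) ^ 2 <= b ^ 2 + d * (2 * b + 1)) by nra.
      assert (H6 : (a + K * d) ^ 2 <= a ^ 2 + d * (2 * K * a + K ^ 2)).
      { assert (0 <= K ^ 2 * (d * (1 - d))).
        { apply Rmult_le_pos; [apply pow_le; lra|]. apply Rmult_le_pos; lra. }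
        nra. }
      unfold v. fold a b.
      assert (H7 : delta * Cmod q ^ 2 <= delta * (b ^ 2 + d * (2 * b + 1)))
        by (apply Rmult_le_compat_l; lra).
      unfold L in Hdl. lra. }
    (* An interior maximum contradicts the gain [4 delta t^2] of the cross sum. *)
    assert (Hpr : Cmod p = r).
    { destruct (Rle_lt_or_eq_dec _ _ Hp) as [Hlt|]; auto. exfalso.
      destruct (Hj p Hp) as (c & Hc).
      destruct (jet_cross_sum _ _ _ Hc) as (K & eps & HK & He & Hcs).
      (* [t] keeps the four points in the disc and makes [K t <= delta]. *)
      set (t := Rmin (Rmin (eps / 2) (r - Cmod p)) (delta / (K + 1))).
      assert (Ht : 0 < t).
      { unfold t. repeat apply Rmin_glb_lt; try lra. apply Rdiv_lt_0_compat; lra. }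
      assert (Ht1 : t <= eps / 2)
        by (unfold t; eapply Rle_trans; [apply Rmin_l|apply Rmin_l]).
      assert (Ht2 : t <= r - Cmod p)
        by (unfold t; eapply Rle_trans; [apply Rmin_l|apply Rmin_r]).
      assert (Ht3 : t * (K + 1) <= delta).
      { replace delta with (delta / (K + 1) * (K + 1)) by (field; lra).
        apply Rmult_le_compat_r; [lra|]. unfold t. apply Rmin_r. }
      specialize (Hcs t ltac:(lra)).
      assert (Hin : forall w, Cmod w = t -> v (p + w)%C <= v p).
      { intros w Hw. apply Hmax. eapply Rle_trans; [apply Cmod_triangle|]. lra. }
      assert (Hm1 : Cmod (RtoC t) = t) by (rewrite Cmod_R, Rabs_pos_eq; lra).
      assert (Hm2 : Cmod (RtoC (- t)) = t)
        by (rewrite Cmod_R, Rabs_Ropp, Rabs_pos_eq; lra).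
      pose proof (Hin _ Hm1) as H1. pose proof (Hin _ Hm2) as H2.
      pose proof (Hin (Ci * RtoC t)%C) as H3. pose proof (Hin (Ci * RtoC (- t))%C) as H4.
      rewrite Cmod_mult, Cmod_Ci, Rmult_1_l in H3, H4.
      specialize (H3 Hm1). specialize (H4 Hm2).
      assert (Hid : cross_sum (fun z => Cmod z ^ 2) p t = 4 * Cmod p ^ 2 + 4 * t ^ 2).
      { unfold cross_sum. rewrite !Cmod2_alt. destruct p as [x y]. simpl. ring. }
      unfold cross_sum, v in *.
      assert (0 < t ^ 2) by now apply pow_lt.
      assert (Hk : K * t ^ 3 < 4 * delta * t ^ 2).
      { replace (K * t ^ 3) with (K * t * t ^ 2) by ring.
        apply Rmult_lt_compat_r; auto. nra. }
      nra. }
    specialize (Hmax z Hz). unfold v in Hmax. rewrite Hpr, Hdr in Hmax.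
    assert (Cmod (F p) ^ 2 <= B ^ 2)
      by (apply pow_incr; split; [apply Cmod_ge_0|auto]).
    assert (0 <= delta * Cmod z ^ 2).
    { apply Rmult_le_pos; [lra|]. apply pow_le, Cmod_ge_0. }
    lra. }
  apply le_epsilon in Hdelta.
  apply Rsqr_incr_0_var; auto. unfold Rsqr. lra.
Qed.

(** * Schwarz's lemma and coefficients of bounded functions *)

(** The smoothness that [max_principle] requires, at all points of the open
    disc.  Unlike analyticity it is checked by algebra on finitely many
    coefficients. *)
Definition regular (F : C -> C) : Prop :=
  forall z, unit_disk z -> exists c, jet 3 F z c.

Lemma analytic_jets F z0 : analytic_in unit_disk F -> unit_disk z0 ->
  exists c, forall n, jet n F z0 c.
Proof.
  intros H Hz. destruct (H z0 Hz) as (c & eps & He & Hc).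
  exists c. now apply pseries_jet with eps.
Qed.

Lemma taylor_jets F a : taylor_in_disk a F -> forall n, jet n F (RtoC 0) a.
Proof.
  intros H. apply pseries_jet with 1; [lra|].
  intros w Hw. rewrite Cplus_0_l. now apply H.
Qed.

Lemma analytic_regular F : analytic_in unit_disk F -> regular F.
Proof.
  intros H z Hz. destruct (analytic_jets F z H Hz) as (c & Hc). eauto.
Qed.

Lemma regular_const a : regular (fun _ => a).
Proof. intros z _. eexists. apply jet_const. Qed.

Lemma regular_plus F G : regular F -> regular G -> regular (fun z => F z + G z)%C.
Proof.
  intros HF HG z Hz. destruct (HF z Hz). destruct (HG z Hz).
  eexists. apply jet_plus; eassumption.
Qed.

Lemma regular_mult F G : regular F -> regular G -> regular (fun z => F z * G z)%C.
Proof.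
  intros HF HG z Hz. destruct (HF z Hz). destruct (HG z Hz).
  eexists. apply jet_mult; eassumption.
Qed.

Lemma regular_scal a F : regular F -> regular (fun z => a * F z)%C.
Proof. intros H. apply regular_mult; auto. apply regular_const. Qed.

Lemma regular_pow F n : regular F -> regular (fun z => F z ^ n)%C.
Proof.
  intros H. induction n as [|n IH]; simpl.
  - apply regular_const.
  - now apply regular_mult.
Qed.

Lemma regular_inv F : regular F -> (forall z, unit_disk z -> F z <> RtoC 0) ->
  regular (fun z => / F z)%C.
Proof.
  intros H H0 z Hz. destruct (H z Hz) as (c & Hc).
  apply (jet_inv _ _ _ Hc). auto.
Qed.

Lemma jet_comp_scal n F z0 c a : Cmod a <= 1 ->
  jet n F (a * z0)%C c ->
  jet n (fun z => F (a * z)%C) z0 (fun k => c k * a ^ k)%C.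
Proof.
  intros Ha (K & eps & HK & He & H).
  exists K, eps. repeat split; auto. intros w Hw.
  assert (Haw : Cmod (a * w) <= Cmod w).
  { rewrite Cmod_mult. pose proof (Cmod_ge_0 w). nra. }
  assert (Hp : forall m d, poly m (fun k => d k * a ^ k)%C w = poly m d (a * w)%C).
  { induction m as [|m IH]; intros d; simpl; auto.
    rewrite <- IH.
    change (shift (fun k => d k * a ^ k)%C) with (fun k => shift d k * (a * a ^ k))%C.
    replace (poly m (fun k => shift d k * (a * a ^ k)) w)%C
      with (poly m (fun k => a * (shift d k * a ^ k)) w)%C
      by (apply poly_ext; intros; ring).
    rewrite poly_scal. ring. }
  rewrite Hp. specialize (H (a * w)%C ltac:(lra)).
  replace (a * (z0 + w))%C with (a * z0 + a * w)%C by ring.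
  eapply Rle_trans; [exact H|]. apply Rmult_le_compat_l; auto.
  apply pow_incr. split; [apply Cmod_ge_0|auto].
Qed.

Lemma jet_id z0 : jet 3 (fun z => z) z0 (fun k => match k with
  | O => z0 | 1%nat => RtoC 1 | _ => RtoC 0 end).
Proof.
  apply bigO_ext with (fun _ => RtoC 0); [|apply bigO_zero].
  intros w. simpl. unfold shift. ring.
Qed.

(** At 0 the coefficients are shifted; elsewhere the quotient is a product of
    [F] and reciprocals of the identity. *)
Lemma regular_div_pow m F c :
  regular F -> (forall k, (k < m)%nat -> c k = RtoC 0) ->
  (forall n, jet n F (RtoC 0) c) -> regular (div_pow m (c m) F).
Proof.
  intros HF Hc Hj z Hz. destruct (Ceq_dec z (RtoC 0)) as [->|Hne].
  - eexists. apply (jet_div_pow m 3 F c); [lia|exact Hc|apply Hj].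
  - destruct (HF z Hz) as (d & Hd).
    destruct (jet_inv _ _ _ (jet_id z) Hne) as (e & He).
    assert (Hp : forall k, exists e', jet 3 (fun z => (/ z) ^ k)%C z e').
    { induction k as [|k (e' & IH)]; simpl.
      - eexists. apply jet_const.
      - eexists. apply jet_mult; eassumption. }
    destruct (Hp m) as (e' & He').
    exists (cauchy d e').
    apply Cmod_gt_0 in Hne.
    apply jet_local with (F := fun z => (F z * (/ z) ^ m)%C) (eps := Cmod z); auto.
    + intros w Hw.
      assert (Hne' : (z + w)%C <> RtoC 0).
      { intros E. assert (z = - w)%C by (replace z with ((z + w) - w)%C by ring; rewrite E; ring).
        subst z. rewrite Cmod_opp in Hw. lra. }
      rewrite div_pow_nonzero by auto. unfold Cdiv. now rewrite Cpow_inv.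
    + now apply jet_mult.
Qed.

Lemma pow_ge_linear r m : 0 <= r <= 1 -> 1 - INR m * (1 - r) <= r ^ m.
Proof.
  intros Hr. induction m as [|m IH].
  - simpl. lra.
  - rewrite S_INR. simpl.
    assert (0 <= r ^ m <= 1).
    { split; [apply pow_le; lra|]. rewrite <- (pow1 m). apply pow_incr. lra. }
    nra.
Qed.

(** The mechanism of Schwarz's lemma: on the circle [|z| = 1 - s] the maximum
    principle bounds [F] by [B / (1 - s)^m], and [s] tends to 0. *)
Lemma disk_bound_of_weighted (F : C -> C) (B : R) (m : nat) : regular F -> 0 <= B ->
  (forall z, unit_disk z -> Cmod z ^ m * Cmod (F z) <= B) ->
  forall z, unit_disk z -> Cmod (F z) <= B.
Proof.
  intros HF HB Hbd z Hz. unfold unit_disk in *.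
  pose proof (Cmod_ge_0 z) as Hz0. pose proof (Cmod_ge_0 (F z)) as HF0.
  pose proof (pos_INR m) as Hm.
  apply le_epsilon. intros e He.
  set (T := INR m * Cmod (F z)).
  assert (HT : 0 <= T) by (apply Rmult_le_pos; auto).
  set (s := Rmin ((1 - Cmod z) / 2) (e / (T + 1))).
  assert (Hs : 0 < s) by (apply Rmin_glb_lt; [lra|apply Rdiv_lt_0_compat; lra]).
  assert (Hs1 : s <= (1 - Cmod z) / 2) by apply Rmin_l.
  assert (Hs2 : s * (T + 1) <= e).
  { replace e with (e / (T + 1) * (T + 1)) by (field; lra).
    apply Rmult_le_compat_r; [lra|]. apply Rmin_r. }
  assert (Hr : 0 < (1 - s) ^ m) by (apply pow_lt; lra).
  assert (H : Cmod (F z) <= B / (1 - s) ^ m).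
  { apply (max_principle F (1 - s)); try lra.
    - apply Rmult_le_pos; auto. apply Rlt_le, Rinv_0_lt_compat; auto.
    - intros y Hy. apply HF. unfold unit_disk. lra.
    - intros y Hy. specialize (Hbd y ltac:(lra)). rewrite Hy in Hbd.
      apply Rmult_le_reg_l with ((1 - s) ^ m); auto.
      replace ((1 - s) ^ m * (B / (1 - s) ^ m)) with B by (field; lra). auto. }
  assert (H' : (1 - s) ^ m * Cmod (F z) <= B).
  { replace B with ((1 - s) ^ m * (B / (1 - s) ^ m)) by (field; lra).
    apply Rmult_le_compat_l; lra. }
  pose proof (pow_ge_linear (1 - s) m ltac:(lra)) as Hp.
  assert ((1 - INR m * s) * Cmod (F z) <= (1 - s) ^ m * Cmod (F z)).
  { apply Rmult_le_compat_r; auto. lra. }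
  assert (s * T <= e) by nra.
  unfold T in *. nra.
Qed.

Fixpoint csum (f : nat -> C) (n : nat) : C :=
  match n with
  | O => RtoC 0
  | S m => (csum f m + f m)%C
  end.

Lemma csum_ext f g n : (forall j, (j < n)%nat -> f j = g j) -> csum f n = csum g n.
Proof.
  induction n as [|n IH]; intros H; simpl; auto.
  rewrite IH, (H n); auto.
Qed.

Lemma csum_scal a f n : csum (fun j => a * f j)%C n = (a * csum f n)%C.
Proof. induction n as [|n IH]; simpl; [|rewrite IH]; ring. Qed.

Lemma csum_const a n : csum (fun _ => a) n = (RtoC (INR n) * a)%C.
Proof.
  induction n as [|n IH]; simpl csum.
  - simpl. ring.
  - rewrite IH, S_INR, RtoC_plus. ring.
Qed.

Lemma csum_geom q n : ((q - 1) * csum (fun j => q ^ j) n = q ^ n - 1)%C.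
Proof.
  induction n as [|n IH]; simpl.
  - ring.
  - rewrite Cmult_plus_distr_l, IH. ring.
Qed.

Lemma Cmod_csum_const f B n : (forall j, (j < n)%nat -> Cmod (f j) <= B) ->
  Cmod (csum f n) <= INR n * B.
Proof.
  induction n as [|n IH]; intros H; simpl csum.
  - rewrite Cmod_0. simpl. lra.
  - eapply Rle_trans; [apply Cmod_triangle|].
    rewrite S_INR. specialize (IH ltac:(auto)). specialize (H n ltac:(auto)). lra.
Qed.

Lemma jet_csum N (F : nat -> C -> C) z0 (c : nat -> nat -> C) n :
  (forall j, (j < n)%nat -> jet N (F j) z0 (c j)) ->
  jet N (fun z => csum (fun j => F j z) n) z0 (fun k => csum (fun j => c j k) n).
Proof.
  induction n as [|n IH]; intros H; simpl.
  - apply jet_coeff_ext with (2 := jet_const N (RtoC 0) z0). now intros [|k].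
  - apply jet_plus; auto.
Qed.

Definition unit_root (m : nat) : C := (cos (2 * PI / INR m), sin (2 * PI / INR m)).

Lemma unit_root_pow m k : (unit_root m ^ k)%C =
  (cos (INR k * (2 * PI / INR m)), sin (INR k * (2 * PI / INR m))).
Proof.
  induction k as [|k IH].
  - simpl. rewrite Rmult_0_l, cos_0, sin_0. reflexivity.
  - rewrite S_INR, Rmult_plus_distr_r, Rmult_1_l, cos_plus, sin_plus.
    simpl Cpow. rewrite IH. unfold unit_root.
    apply injective_projections; simpl; ring.
Qed.

Lemma unit_root_Cmod m : Cmod (unit_root m) = 1.
Proof.
  unfold Cmod, unit_root. rewrite <- sqrt_1 at 1. f_equal. simpl.
  pose proof (sin2_cos2 (2 * PI / INR m)) as H. unfold Rsqr in H. lra.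
Qed.

Lemma unit_root_period m : (0 < m)%nat -> (unit_root m ^ m)%C = RtoC 1.
Proof.
  intros Hm. apply lt_0_INR in Hm. rewrite unit_root_pow.
  replace (INR m * (2 * PI / INR m)) with (2 * PI) by (field; lra).
  rewrite cos_2PI, sin_2PI. reflexivity.
Qed.

Lemma unit_root_primitive m k : (0 < k < m)%nat -> (unit_root m ^ k)%C <> RtoC 1.
Proof.
  intros [Hk Hkm] E. rewrite unit_root_pow in E.
  apply (f_equal fst) in E. simpl in E.
  apply lt_0_INR in Hk. apply lt_INR in Hkm. pose proof PI_RGT_0 as Hpi.
  set (t := INR k / INR m).
  assert (Ht : 0 < t < 1).
  { unfold t. split; [apply Rdiv_lt_0_compat; lra|].
    apply Rmult_lt_reg_r with (INR m); [lra|].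
    unfold Rdiv. rewrite Rmult_assoc, Rinv_l by lra. lra. }
  replace (INR k * (2 * PI / INR m)) with (2 * (t * PI)) in E by (unfold t; field; lra).
  rewrite cos_2a_sin in E.
  assert (0 < sin (t * PI)) by (apply sin_gt_0; nra).
  nra.
Qed.

(** Averaging over the rotations by the [m]-th roots of unity keeps bounds and
    kills the coefficients of degree not divisible by [m]. *)
Definition rot_mean (m : nat) (F : C -> C) (z : C) : C :=
  (/ RtoC (INR m) * csum (fun j => F (unit_root m ^ j * z)) m)%C.

Lemma unit_root_pow_Cmod m j : Cmod (unit_root m ^ j)%C = 1.
Proof. now rewrite Cmod_pow, unit_root_Cmod, pow1. Qed.

Lemma unit_root_rotation_disk m j z : unit_disk z -> unit_disk (unit_root m ^ j * z)%C.
Proof.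
  unfold unit_disk. rewrite Cmod_mult, unit_root_pow_Cmod. lra.
Qed.

Lemma rot_mean_regular m F : regular F -> regular (rot_mean m F).
Proof.
  intros H. apply regular_scal. intros z Hz.
  set (P := fun j c => jet 3 F (unit_root m ^ j * z)%C c).
  assert (HP : forall j, exists c, P j c).
  { intros j. apply H. now apply unit_root_rotation_disk. }
  set (c := fun j => proj1_sig (constructive_indefinite_description _ (HP j))).
  eexists. apply (jet_csum 3 (fun j z => F (unit_root m ^ j * z)%C)).
  intros j _. apply (jet_comp_scal 3 F z (c j)).
  - rewrite unit_root_pow_Cmod. lra.
  - exact (proj2_sig (constructive_indefinite_description _ (HP j))).
Qed.

Lemma rot_mean_bound m F B : (0 < m)%nat ->
  (forall z, unit_disk z -> Cmod (F z) <= B) ->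
  forall z, unit_disk z -> Cmod (rot_mean m F z) <= B.
Proof.
  intros Hm H z Hz. apply lt_0_INR in Hm. unfold rot_mean.
  rewrite Cmod_mult, Cmod_inv by (intros E; apply RtoC_inj in E; lra).
  rewrite Cmod_R, Rabs_pos_eq by lra.
  apply Rmult_le_reg_l with (INR m); auto.
  rewrite <- Rmult_assoc, Rinv_r, Rmult_1_l by lra.
  apply Cmod_csum_const. intros j _. apply H. now apply unit_root_rotation_disk.
Qed.

Lemma rot_mean_jet m F c : (0 < m)%nat -> (forall n, jet n F (RtoC 0) c) ->
  exists d, (forall n, jet n (rot_mean m F) (RtoC 0) d) /\
    d O = c O /\ (forall k, (0 < k < m)%nat -> d k = RtoC 0) /\ d m = c m.
Proof.
  intros Hm H.
  assert (Hm0 : RtoC (INR m) <> RtoC 0).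
  { apply lt_0_INR in Hm. intros E; apply RtoC_inj in E; lra. }
  exists (fun k => / RtoC (INR m) * csum (fun j => c k * (unit_root m ^ j) ^ k) m)%C.
  assert (Hone : forall k, (forall j, ((unit_root m ^ j) ^ k = 1)%C) ->
    (/ RtoC (INR m) * csum (fun j => c k * (unit_root m ^ j) ^ k) m = c k)%C).
  { intros k Hk. rewrite (csum_ext _ (fun _ => c k)).
    - rewrite csum_const. field. auto.
    - intros j _. rewrite Hk. ring. }
  split; [|split; [|split]].
  - intros n. apply jet_scal.
    apply (jet_csum n (fun j z => F (unit_root m ^ j * z)%C) (RtoC 0)
            (fun j k => c k * (unit_root m ^ j) ^ k)%C).
    intros j _. apply jet_comp_scal.
    + rewrite unit_root_pow_Cmod. lra.
    + rewrite Cmult_0_r. apply H.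
  - apply Hone. reflexivity.
  - intros k Hk. rewrite csum_scal.
    rewrite (csum_ext _ (fun j => (unit_root m ^ k) ^ j)%C).
    + assert (E := csum_geom (unit_root m ^ k)%C m).
      assert (Hk1 := unit_root_primitive m k Hk).
      rewrite <- Cpow_mult_r, Nat.mul_comm, Cpow_mult_r, unit_root_period, Cpow_1_l in E
        by auto.
      assert (E' : csum (fun j => (unit_root m ^ k) ^ j)%C m = RtoC 0).
      { assert (Hne : (unit_root m ^ k - 1)%C <> RtoC 0).
        { intros E0. apply Hk1.
          replace (unit_root m ^ k)%C with ((unit_root m ^ k - 1) + 1)%C by ring.
          rewrite E0. ring. }
        replace (csum (fun j => (unit_root m ^ k) ^ j)%C m)
          with (/ (unit_root m ^ k - 1) * ((unit_root m ^ k - 1)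
                * csum (fun j => (unit_root m ^ k) ^ j) m))%C by (field; auto).
        rewrite E. ring. }
      rewrite E'. ring.
    + intros j _. now rewrite <- !Cpow_mult_r, Nat.mul_comm.
  - apply Hone. intros j.
    rewrite <- Cpow_mult_r, Nat.mul_comm, Cpow_mult_r, unit_root_period, Cpow_1_l; auto.
Qed.

Lemma schwarz_pick x y : Cmod x <= 1 -> Cmod y <= 1 ->
  Cmod (x - y)%C <= Cmod (1 - Cconj y * x)%C.
Proof.
  intros Hx Hy.
  assert (Hx2 : Cmod x ^ 2 <= 1)
    by (rewrite <- (pow1 2); apply pow_incr; split; [apply Cmod_ge_0|auto]).
  assert (Hy2 : Cmod y ^ 2 <= 1)
    by (rewrite <- (pow1 2); apply pow_incr; split; [apply Cmod_ge_0|auto]).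
  assert (H : Cmod (1 - Cconj y * x)%C ^ 2 - Cmod (x - y)%C ^ 2
              = (1 - Cmod x ^ 2) * (1 - Cmod y ^ 2)).
  { rewrite !Cmod2_alt. destruct x, y. simpl. ring. }
  apply Rsqr_incr_0_var; [|apply Cmod_ge_0].
  unfold Rsqr. nra.
Qed.

(** With [c0 = c O] and [H = rot_mean m h = c0 + c_m z^m + O(z^(m+1))], the
    Schwarz-Pick inequality shows that
    [(H - c0) / (z^m (1 - conj c0 * H))] has modulus at most [|z|^(-m)], hence at
    most 1 by [disk_bound_of_weighted]; its value at 0 is
    [c_m / (1 - |c0|^2)].  The proof works with [th * H] for [th < 1], so that
    the denominator cannot vanish, and lets [th] tend to 1. *)
Lemma coeff_bound h c m : (0 < m)%nat -> regular h ->
  (forall n, jet n h (RtoC 0) c) ->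
  (forall z, unit_disk z -> Cmod (h z) <= 1) ->
  Cmod (c m) <= 1 - Cmod (c O) ^ 2.
Proof.
  intros Hm Hreg Hj Hb.
  assert (H0 : unit_disk (RtoC 0)) by (unfold unit_disk; rewrite Cmod_0; lra).
  assert (Hc0 : Cmod (c O) <= 1).
  { rewrite <- (jet_value 1 _ _ _ ltac:(lia) (Hj 1%nat)). auto. }
  pose proof (Cmod_ge_0 (c O)) as Hc00. pose proof (Cmod_ge_0 (c m)) as Hcm0.
  destruct (rot_mean_jet m h c Hm Hj) as (d & Hd & Hd0 & Hdk & Hdm).
  pose proof (rot_mean_regular m h Hreg) as HregH.
  pose proof (rot_mean_bound m h 1 Hm Hb) as HbH.
  set (H := rot_mean m h) in *.
  assert (Htheta : forall th, 0 < th < 1 ->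
    th * Cmod (c m) <= 1 - th ^ 2 * Cmod (c O) ^ 2).
  { intros th Hth.
    assert (Hthm : Cmod (RtoC th) = th) by (rewrite Cmod_R, Rabs_pos_eq; lra).
    set (y := (RtoC th * c O)%C).
    assert (Hy : Cmod y <= th) by (unfold y; rewrite Cmod_mult, Hthm; nra).
    set (N := fun z => (RtoC th * H z + (- y))%C).
    set (A := fun z => (1 + (- Cconj y) * (RtoC th * H z))%C).
    assert (HA0 : forall z, unit_disk z -> 1 - th ^ 2 <= Cmod (A z)).
    { intros z Hz. specialize (HbH z Hz). pose proof (Cmod_ge_0 (H z)).
      assert (Cmod ((- Cconj y) * (RtoC th * H z))%C <= th ^ 2).
      { rewrite !Cmod_mult, Cmod_opp, Cmod_conj, Hthm.
        pose proof (Cmod_ge_0 y).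
        assert (th * Cmod (H z) <= th) by nra.
        assert (0 <= th * Cmod (H z)) by nra. nra. }
      assert (Cmod 1 <= Cmod (A z) + Cmod ((- Cconj y) * (RtoC th * H z))%C).
      { replace (RtoC 1) with (A z + - ((- Cconj y) * (RtoC th * H z)))%C at 1
          by (unfold A; ring).
        eapply Rle_trans; [apply Cmod_triangle|]. rewrite Cmod_opp. lra. }
      rewrite Cmod_1 in *. lra. }
    assert (HAne : forall z, unit_disk z -> A z <> RtoC 0).
    { intros z Hz. apply Cmod_gt_0. specialize (HA0 z Hz). nra. }
    assert (HregN : regular N).
    { apply regular_plus; [now apply regular_scal|apply regular_const]. }
    assert (HregA : regular A).
    { apply regular_plus; [apply regular_const|].
      apply regular_scal. now apply regular_scal. }
    set (dN := fun k => (RtoC th * d k + const_coeff (- y) k)%C).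
    assert (HjN : forall n, jet n N (RtoC 0) dN).
    { intros n. apply jet_plus; [apply jet_scal; auto|apply jet_const]. }
    assert (HdN : forall k, (k < m)%nat -> dN k = RtoC 0).
    { intros [|k] Hk; unfold dN, const_coeff.
      - rewrite Hd0. unfold y. ring.
      - rewrite Hdk by lia. ring. }
    assert (HdNm : dN m = (RtoC th * c m)%C).
    { unfold dN. rewrite Hdm. destruct m; [lia|]. simpl. ring. }
    pose proof (regular_div_pow m N dN HregN HdN HjN) as HregD.
    set (D := div_pow m (dN m) N) in *.
    assert (HQ := disk_bound_of_weighted (fun z => D z * / A z)%C 1 m
      (regular_mult _ _ HregD (regular_inv _ HregA HAne)) ltac:(lra)).
    assert (HQ0 : Cmod (D (RtoC 0) * / A (RtoC 0))%C <= 1).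
    { apply HQ; auto. intros z Hz. destruct (Ceq_dec z (RtoC 0)) as [->|Hne].
      - rewrite Cmod_0, pow_i by auto. lra.
      - rewrite <- Cmod_pow, <- Cmod_mult. unfold D.
        rewrite div_pow_nonzero by auto.
        replace (z ^ m * (N z / z ^ m * / A z))%C with (N z / A z)%C
          by (field; split; [auto|now apply Cpow_nz]).
        specialize (HAne z Hz).
        rewrite Cmod_div by auto. apply Cmod_gt_0 in HAne.
        apply Rmult_le_reg_r with (Cmod (A z)); auto.
        unfold Rdiv. rewrite Rmult_assoc, Rinv_l, Rmult_1_r, Rmult_1_l by lra.
        replace (N z) with (RtoC th * H z - y)%C by (unfold N; ring).
        replace (A z) with (1 - Cconj y * (RtoC th * H z))%C by (unfold A; ring).
        apply schwarz_pick; [|lra].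
        rewrite Cmod_mult, Hthm. specialize (HbH z Hz). pose proof (Cmod_ge_0 (H z)). nra. }
    assert (HA00 : A (RtoC 0) = RtoC (1 - th ^ 2 * Cmod (c O) ^ 2)).
    { unfold A. rewrite (jet_value 1 _ _ _ ltac:(lia) (Hd 1%nat)), Hd0.
      unfold y. rewrite RtoC_minus, RtoC_mult, Cmod2_conj, Cmult_conj.
      replace (Cconj (RtoC th)) with (RtoC th)
        by (apply injective_projections; simpl; ring).
      rewrite RtoC_pow. simpl. ring. }
    assert (Hpos : 0 < 1 - th ^ 2 * Cmod (c O) ^ 2).
    { assert (Cmod (c O) ^ 2 <= 1) by nra. assert (th ^ 2 < 1) by nra.
      assert (0 <= th ^ 2) by nra. nra. }
    unfold D in HQ0. rewrite div_pow_zero, HdNm, HA00, <- RtoC_inv in HQ0 by lra.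
    rewrite !Cmod_mult, Hthm, Cmod_R, Rabs_pos_eq in HQ0
      by (apply Rlt_le, Rinv_0_lt_compat; lra).
    apply Rmult_le_compat_r with (r := 1 - th ^ 2 * Cmod (c O) ^ 2) in HQ0; [|lra].
    rewrite Rmult_assoc, Rinv_l in HQ0 by lra. lra. }
  apply le_epsilon. intros e He.
  set (T := Cmod (c m) + 2 * Cmod (c O) ^ 2).
  assert (HT : 0 <= T) by (unfold T; nra).
  (* Let [th = 1 - s] tend to 1; the loss is at most [s T]. *)
  set (s := Rmin (1 / 2) (e / (T + 1))).
  assert (Hs : 0 < s) by (apply Rmin_glb_lt; [lra|apply Rdiv_lt_0_compat; lra]).
  assert (Hs1 : s <= 1 / 2) by apply Rmin_l.
  assert (Hs2 : s * (T + 1) <= e).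
  { replace e with (e / (T + 1) * (T + 1)) by (field; lra).
    apply Rmult_le_compat_r; [lra|]. apply Rmin_r. }
  specialize (Htheta (1 - s) ltac:(lra)).
  assert (0 <= s ^ 2 * Cmod (c O) ^ 2) by (apply Rmult_le_pos; nra).
  unfold T in *. nra.
Qed.

(** * Coefficients of quasi-subordinate functions *)
Lemma bigO_comp N E om : bigO N E -> bigO 1 om -> bigO N (fun w => E (om w)).
Proof.
  intros (K & eps & HK & He & HE) (L & eps' & HL & He' & Hom).
  exists (K * L ^ N), (Rmin eps' (eps / (L + 1))). repeat split.
  - apply Rmult_le_pos; auto. now apply pow_le.
  - apply Rmin_glb_lt; auto. apply Rdiv_lt_0_compat; lra.
  - intros w Hw.
    pose proof (Rmin_l eps' (eps / (L + 1))). pose proof (Rmin_r eps' (eps / (L + 1))).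
    specialize (Hom w ltac:(lra)). rewrite pow_1 in Hom.
    pose proof (Cmod_ge_0 w).
    assert (Cmod w * (L + 1) < eps).
    { replace eps with (eps / (L + 1) * (L + 1)) by (field; lra).
      apply Rmult_lt_compat_r; lra. }
    eapply Rle_trans; [apply HE; nra|].
    rewrite Rmult_assoc, <- Rpow_mult_distr.
    apply Rmult_le_compat_l; auto. apply pow_incr. split; [apply Cmod_ge_0|auto].
Qed.

Lemma poly_csum n c w :
  poly (S n) c w = (c O + csum (fun j => c (S j) * w ^ S j) n)%C.
Proof.
  induction n as [|n IH].
  - simpl. ring.
  - rewrite poly_last, IH. simpl. ring.
Qed.

(** Factoring [om = z * psi] turns [Phi * om^(j+1)] into
    [z^(j+1) * (Phi * psi^(j+1))], whose second factor is bounded by 1 thanks to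
    Schwarz's lemma, so that [coeff_bound] applies to it. *)
Lemma subordinate_factor (Phi om : C -> C) : class_B Phi -> class_B0 om ->
  exists psi : C -> C, (forall z, om z = z * psi z)%C /\
  bigO 0 Phi /\ bigO 0 psi /\
  exists e : nat -> nat -> C,
    forall j,
      (forall n, jet n (fun z => Phi z * psi z ^ S j)%C (RtoC 0) (e j)) /\
      Cmod (e j O) <= 1 /\
      (forall m, (0 < m)%nat -> Cmod (e j m) <= 1 - Cmod (e j O) ^ 2).
Proof.
  intros [HPa HPb] [[Hoa Hob] Ho0].
  assert (H0 : unit_disk (RtoC 0)) by (unfold unit_disk; rewrite Cmod_0; lra).
  destruct (analytic_jets Phi _ HPa H0) as (p & Hp).
  destruct (analytic_jets om _ Hoa H0) as (c & Hc).
  assert (Hc0 : forall k, (k < 1)%nat -> c k = RtoC 0).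
  { intros k Hk. replace k with O by lia.
    now rewrite <- (jet_value 1 _ _ _ ltac:(lia) (Hc 1%nat)). }
  set (psi := div_pow 1 (c 1%nat) om).
  assert (Hpsi : forall z, om z = (z * psi z)%C).
  { intros z. destruct (Ceq_dec z (RtoC 0)) as [->|Hne].
    - rewrite Ho0. ring.
    - unfold psi. rewrite div_pow_nonzero by auto. rewrite Cpow_1_r. field. auto. }
  assert (Hreg : regular psi)
    by (apply regular_div_pow; auto; now apply analytic_regular).
  assert (Hpsi1 : forall z, unit_disk z -> Cmod (psi z) <= 1).
  { apply (disk_bound_of_weighted psi 1 1); auto; [lra|].
    intros z Hz. rewrite pow_1, <- Cmod_mult, <- Hpsi. auto. }
  assert (Hpsij : forall n, jet n psi (RtoC 0) (fun k => c (1 + k)%nat)).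
  { intros n. apply (jet_weaken (S n)); [lia|].
    apply jet_div_pow; auto. lia. }
  assert (Hpow : forall k, exists q, forall n, jet n (fun z => psi z ^ k)%C (RtoC 0) q).
  { induction k as [|k (q & IH)]; simpl.
    - eexists. intros n. apply jet_const.
    - eexists. intros n. apply jet_mult; [apply Hpsij|apply IH]. }
  set (q := fun k => proj1_sig (constructive_indefinite_description _ (Hpow k))).
  assert (Hq : forall k n, jet n (fun z => psi z ^ k)%C (RtoC 0) (q k)).
  { intros k. exact (proj2_sig (constructive_indefinite_description _ (Hpow k))). }
  exists psi. split; [exact Hpsi|]. split; [|split].
  { apply bigO_ext with (2 := jet_bounded 1 _ _ _ (Hp 1%nat)).
    intros w. now rewrite Cplus_0_l. }
  { apply bigO_ext with (2 := jet_bounded 1 _ _ _ (Hpsij 1%nat)).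
    intros w. now rewrite Cplus_0_l. }
  exists (fun j => cauchy p (q (S j))). intros j.
  assert (Hb : forall z, unit_disk z -> Cmod (Phi z * psi z ^ S j)%C <= 1).
  { intros z Hz. rewrite Cmod_mult, Cmod_pow.
    rewrite <- (Rmult_1_r 1). apply Rmult_le_compat; auto using Cmod_ge_0.
    - apply pow_le, Cmod_ge_0.
    - rewrite <- (pow1 (S j)). apply pow_incr. split; [apply Cmod_ge_0|auto]. }
  assert (Hj : forall n, jet n (fun z => Phi z * psi z ^ S j)%C (RtoC 0)
                             (cauchy p (q (S j)))).
  { intros n. apply jet_mult; auto. }
  split; [exact Hj|split].
  - rewrite <- (jet_value 1 _ _ _ ltac:(lia) (Hj 1%nat)). now apply Hb.
  - intros m Hm. apply (coeff_bound (fun z => Phi z * psi z ^ S j)%C); auto.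
    apply regular_mult; [now apply analytic_regular|now apply regular_pow].
Qed.

(** Only the germs at 0 count: [g(om)] may be replaced by a truncation of the
    power series of [g] at [om], as [om = O(w)], and the coefficient of degree
    [i + 1] is read off by uniqueness of expansions. *)
Lemma subordinate_coeff f g a b Phi om psi e :
  taylor_in_disk a f -> taylor_in_disk b g ->
  (forall z, om z = z * psi z)%C ->
  bigO 0 Phi -> bigO 0 psi ->
  (forall z, unit_disk z -> f z - f (RtoC 0) = Phi z * (g (om z) - g (RtoC 0)))%C ->
  (forall j n, jet n (fun z => Phi z * psi z ^ S j)%C (RtoC 0) (e j)) ->
  forall i, a (S i) = csum (fun j => b (S j) * e j (i - j)%nat)%C (S i).
Proof.
  intros Hf Hg Hom HPhi Hpsi Hfg He i.
  pose proof (taylor_jets f a Hf) as Ja. pose proof (taylor_jets g b Hg) as Jb.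
  set (N := S (S i)).
  assert (Hom1 : bigO 1 om).
  { apply bigO_ext with (2 := bigO_mult 1 0 _ _ bigO_id Hpsi). intros; now rewrite Hom. }
  assert (H1 : jet N (fun z => f z + - f (RtoC 0))%C (RtoC 0)
    (fun k => a k + const_coeff (- f (RtoC 0)) k)%C)
    by (apply jet_plus; [apply Ja|apply jet_const]).
  assert (H2 : jet N (fun z => csum (fun j =>
        (b (S j) * (z ^ S j * (Phi z * psi z ^ S j)))%C) (S i)) (RtoC 0)
      (fun k => csum (fun j => (b (S j) *
        (if (k <? S j)%nat then RtoC 0 else e j (k - S j)%nat))%C) (S i))).
  { apply (jet_csum N (fun j z => b (S j) * (z ^ S j * (Phi z * psi z ^ S j)))%C
      (RtoC 0) (fun j k => b (S j) *
        (if (k <? S j)%nat then RtoC 0 else e j (k - S j)%nat))%C).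
    intros j Hj. apply jet_scal.
    apply (jet_weaken (S j + N)); [lia|]. apply jet_mul_pow. apply He. }
  assert (Hg0 : g (RtoC 0) = b O) by (apply (jet_value 1 _ _ _ ltac:(lia) (Jb 1%nat))).
  assert (H3 : jet N (fun z => f z + - f (RtoC 0))%C (RtoC 0)
      (fun k => csum (fun j => (b (S j) *
        (if (k <? S j)%nat then RtoC 0 else e j (k - S j)%nat))%C) (S i))).
  (* What the truncation of [g] leaves out is O(om^N), hence O(w^N). *)
  { assert (Hrem : bigO N (fun w => Phi w * (g (RtoC 0 + om w) - poly N b (om w)))%C).
    { apply (bigO_mult 0 N _ (fun w => (g (RtoC 0 + om w) - poly N b (om w))%C) HPhi).
      exact (bigO_comp N _ om (Jb N) Hom1). }
    apply (bigO_local N _ _ 1 Rlt_0_1) with (2 := bigO_plus _ _ _ H2 Hrem).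
    intros w Hw. rewrite !Cplus_0_l.
    replace (f w + - f (RtoC 0))%C with (Phi w * (g (om w) - g (RtoC 0)))%C
      by (rewrite <- Hfg; [ring|exact Hw]).
    unfold N. rewrite (poly_csum (S i) b), Hg0.
    replace (csum (fun j => b (S j) * (w ^ S j * (Phi w * psi w ^ S j))) (S i))%C
      with (Phi w * csum (fun j => b (S j) * om w ^ S j) (S i))%C.
    - ring.
    - rewrite <- csum_scal. apply csum_ext. intros j _.
      rewrite Hom, Cpow_mult_l. ring. }
  pose proof (jet_unique N _ _ _ _ H1 H3 (S i) ltac:(unfold N; lia)) as E.
  cbv beta in E. simpl const_coeff in E. rewrite Cplus_0_r in E. rewrite E.
  apply csum_ext. intros j Hj.
  destruct (Nat.ltb_spec (S i) (S j)); [lia|]. f_equal.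
Qed.

(** * The majorant inequality *)
Fixpoint rsum (f : nat -> R) (n : nat) : R :=
  match n with
  | O => 0
  | S m => rsum f m + f m
  end.

Lemma rsum_le f g n : (forall j, (j < n)%nat -> f j <= g j) -> rsum f n <= rsum g n.
Proof.
  induction n as [|n IH]; intros H; simpl; [lra|].
  specialize (IH ltac:(auto)). specialize (H n ltac:(auto)). lra.
Qed.

Lemma rsum_ext f g n : (forall j, (j < n)%nat -> f j = g j) -> rsum f n = rsum g n.
Proof.
  induction n as [|n IH]; intros H; simpl; auto. rewrite IH, (H n); auto.
Qed.

Lemma rsum_scal a f n : rsum (fun j => a * f j) n = a * rsum f n.
Proof. induction n as [|n IH]; simpl; [|rewrite IH]; ring. Qed.

Lemma rsum_plus f g n : rsum (fun j => f j + g j) n = rsum f n + rsum g n.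
Proof. induction n as [|n IH]; simpl; [|rewrite IH]; ring. Qed.

Lemma sum_n_rsum f n : sum_n f n = rsum f (S n).
Proof.
  induction n as [|n IH].
  - rewrite sum_O. symmetry. apply Rplus_0_l.
  - rewrite sum_Sn, IH. reflexivity.
Qed.

Lemma Cmod_csum f n : Cmod (csum f n) <= rsum (fun j => Cmod (f j)) n.
Proof.
  induction n as [|n IH]; simpl.
  - rewrite Cmod_0. lra.
  - eapply Rle_trans; [apply Cmod_triangle|]. lra.
Qed.

Lemma rsum_triangle (F : nat -> nat -> R) N :
  rsum (fun i => rsum (fun j => F j (i - j)%nat) (S i)) N
  = rsum (fun j => rsum (F j) (N - j)) N.
Proof.
  induction N as [|N IH]; auto.
  change (rsum (fun i => rsum (fun j => F j (i - j)%nat) (S i)) (S N))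
    with (rsum (fun i => rsum (fun j => F j (i - j)%nat) (S i)) N
          + (rsum (fun j => F j (N - j)%nat) N + F N (N - N)%nat)).
  change (rsum (fun j => rsum (F j) (S N - j)) (S N))
    with (rsum (fun j => rsum (F j) (S N - j)) N + rsum (F N) (S N - N)).
  rewrite IH, <- Rplus_assoc, <- rsum_plus.
  replace (S N - N)%nat with 1%nat by lia. replace (N - N)%nat with O by lia.
  change (rsum (F N) 1) with (0 + F N O). rewrite Rplus_0_l. f_equal.
  apply rsum_ext. intros j Hj. now rewrite Nat.sub_succ_l by lia.
Qed.

Lemma r0_sq r : 0 <= r <= r0 -> r < 1 / 2 /\ 2 / 3 <= (1 - r) ^ 2.
Proof.
  unfold r0. intros [Hr0 Hr].
  pose proof (sqrt_pos (2 / 3)). pose proof (sqrt_sqrt (2 / 3) ltac:(lra)).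
  split; nra.
Qed.

(** [(1 - r)^2] times the sum telescopes to
    [1 - (1 + n (1 - r)) r^n]. *)
Lemma rsum_arith_geom r n : 0 <= r <= 1 ->
  (1 - r) ^ 2 * rsum (fun m => INR (S m) * r ^ m) n <= 1.
Proof.
  intros Hr.
  assert (E : (1 - r) ^ 2 * rsum (fun m => INR (S m) * r ^ m) n
              = 1 - (1 + INR n * (1 - r)) * r ^ n).
  { induction n as [|n IH].
    - simpl. ring.
    - change (rsum ?f (S n)) with (rsum f n + f n).
      rewrite Rmult_plus_distr_l, IH, !S_INR. simpl. ring. }
  rewrite E.
  assert (0 <= r ^ n) by (apply pow_le; lra). pose proof (pos_INR n).
  assert (0 <= INR n * (1 - r)) by (apply Rmult_le_pos; lra).
  nra.
Qed.

(** Where the radius comes from: with [p = x O], the sum is at most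
    [p - (1 - p^2) + (1 - p^2) / (1 - r)^2], and [1 / (1 - r)^2 <= 3/2] holds
    exactly up to [r0]; what remains is
    [p + (1 - p^2)/2 <= 1], that is, [(1 - p)^2 >= 0]. *)
Lemma bounded_coeff_sum (x : nat -> R) r n : 0 <= r <= r0 ->
  0 <= x O <= 1 -> (forall m, (0 < m)%nat -> x m <= 1 - x O ^ 2) ->
  rsum (fun m => INR (S m) * x m * r ^ m) n <= 1.
Proof.
  intros Hr Hx0 Hx. destruct (r0_sq r Hr) as [Hr1 Hr2].
  set (p := x O) in *.
  assert (H : rsum (fun m => INR (S m) * x m * r ^ m) n
     <= (1 - p ^ 2) * rsum (fun m => INR (S m) * r ^ m) n
        + rsum (fun m => match m with O => p - (1 - p ^ 2) | _ => 0 end) n).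
  { rewrite <- rsum_scal, <- rsum_plus. apply rsum_le. intros [|m] _.
    - simpl. fold p. lra.
    - specialize (Hx (S m) ltac:(lia)).
      assert (0 <= INR (S (S m)) * r ^ S m).
      { apply Rmult_le_pos; [apply pos_INR|apply pow_le; lra]. }
      nra. }
  destruct n as [|n]; [simpl; lra|].
  assert (E : rsum (fun m => match m with O => p - (1 - p ^ 2) | _ => 0 end) (S n)
              = p - (1 - p ^ 2)).
  { clear. induction n as [|n IH]; [simpl; ring|].
    change (rsum ?f (S (S n))) with (rsum f (S n) + 0) . rewrite IH. ring. }
  rewrite E in H.
  pose proof (rsum_arith_geom r (S n) ltac:(lra)) as Hag.
  set (G := rsum (fun m => INR (S m) * r ^ m) (S n)) in *.
  assert (0 <= 1 - p ^ 2) by nra.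
  assert (G <= 3 / 2) by nra.
  assert ((1 - p ^ 2) * G <= (1 - p ^ 2) * (3 / 2)) by (apply Rmult_le_compat_l; lra).
  nra.
Qed.

(** After exchanging the sums, [j + m + 1 <= (j + 1)(m + 1)] separates the
    weight, and the inner sum is the one of [bounded_coeff_sum].  The worst
    case is [j = 0], where the weights agree. *)
Lemma partial_majorant (A B : nat -> C) (e : nat -> nat -> C) r N :
  0 <= r <= r0 ->
  (forall i, A i = csum (fun j => B j * e j (i - j)%nat)%C (S i)) ->
  (forall j, Cmod (e j O) <= 1) ->
  (forall j m, (0 < m)%nat -> Cmod (e j m) <= 1 - Cmod (e j O) ^ 2) ->
  rsum (fun i => INR (S i) * Cmod (A i) * r ^ i) N
  <= rsum (fun i => INR (S i) * Cmod (B i) * r ^ i) N.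
Proof.
  intros Hr HA He0 He.
  set (F := fun j m => INR (S (j + m)) * r ^ (j + m) * (Cmod (B j) * Cmod (e j m))).
  apply Rle_trans with (rsum (fun i => rsum (fun j => F j (i - j)%nat) (S i)) N).
  - apply rsum_le. intros i _. rewrite HA.
    apply Rle_trans with (INR (S i) * r ^ i *
      rsum (fun j => Cmod (B j) * Cmod (e j (i - j)%nat)) (S i)).
    + rewrite (Rmult_comm (INR (S i))), Rmult_assoc, Rmult_comm.
      apply Rmult_le_compat_l.
      * apply Rmult_le_pos; [apply pos_INR|apply pow_le; lra].
      * eapply Rle_trans; [apply Cmod_csum|]. apply rsum_le. intros j _.
        rewrite Cmod_mult. lra.
    + rewrite <- rsum_scal. right. apply rsum_ext. intros j Hj. unfold F.
      now replace (j + (i - j))%nat with i by lia.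
  - rewrite rsum_triangle. apply rsum_le. intros j _.
    apply Rle_trans with (INR (S j) * Cmod (B j) * r ^ j *
      rsum (fun m => INR (S m) * Cmod (e j m) * r ^ m) (N - j)).
    + rewrite <- rsum_scal. apply rsum_le. intros m _. unfold F.
      rewrite pow_add.
      assert (Hi : INR (S (j + m)) <= INR (S j) * INR (S m)).
      { rewrite <- mult_INR. apply le_INR. nia. }
      assert (0 <= r ^ j * r ^ m) by (apply Rmult_le_pos; apply pow_le; lra).
      assert (0 <= Cmod (B j) * Cmod (e j m)) by (apply Rmult_le_pos; apply Cmod_ge_0).
      assert (0 <= r ^ j * r ^ m * (Cmod (B j) * Cmod (e j m)))
        by (now apply Rmult_le_pos).
      nra.
    + rewrite <- (Rmult_1_r (INR (S j) * Cmod (B j) * r ^ j)) at 2.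
      apply Rmult_le_compat_l.
      * repeat apply Rmult_le_pos; [apply pos_INR|apply Cmod_ge_0|apply pow_le; lra].
      * apply (bounded_coeff_sum (fun m => Cmod (e j m))); auto.
        split; auto. apply Cmod_ge_0.
Qed.

Lemma Cmod_deriv_coeff a n : Cmod (deriv_coeff a n) = INR (S n) * Cmod (a (S n)).
Proof.
  unfold deriv_coeff. rewrite Cmod_mult, Cmod_R, Rabs_pos_eq; auto. apply pos_INR.
Qed.

(** Convergence for the dominating function; the radius 1/2 is a convenient
    value between [r0] and 1. *)
Lemma majorant_ex_series b g r : taylor_in_disk b g -> 0 <= r < 1 / 2 ->
  ex_series (fun n => Cmod (deriv_coeff b n) * r ^ n).
Proof.
  intros Hb Hr.
  assert (Hd : unit_disk (RtoC (1 / 2)))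
    by (unfold unit_disk; rewrite Cmod_R, Rabs_pos_eq; lra).
  destruct (pseries_coeff_bounded b (1 / 2) _ ltac:(lra) (Hb _ Hd)) as (M & HM & HMk).
  set (beta := fun n => Cmod (b n)).
  assert (Hcv : Rbar_le (1 / 2) (CV_radius beta)).
  { apply (proj1 (CV_radius_bounded beta)). exists M. intros n. unfold beta.
    rewrite Rabs_pos_eq; auto. apply Rmult_le_pos; [apply Cmod_ge_0|apply pow_le; lra]. }
  assert (Hex : ex_pseries (PS_derive beta) r).
  { apply ex_pseries_derive. rewrite Rabs_pos_eq by lra.
    apply Rbar_lt_le_trans with (1 / 2); auto. simpl. lra. }
  destruct Hex as (l & Hl). exists l. apply is_pseries_R in Hl.
  apply is_series_ext with (2 := Hl). intros n.
  rewrite Cmod_deriv_coeff. reflexivity.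
Qed.

(** The partial sums of [u] increase and are bounded by the sum of [v], so
    their limit is a real number. *)
Lemma Series_le_partial (u v : nat -> R) :
  (forall n, 0 <= u n) -> ex_series v ->
  (forall N, rsum u N <= rsum v N) -> Series u <= Series v.
Proof.
  intros Hu (l & Hl) H.
  rewrite (is_series_unique _ _ Hl).
  assert (Hle : Rbar_le (Lim_seq (sum_n u)) l).
  { rewrite <- (is_lim_seq_unique (sum_n v) (Finite l) Hl). apply Lim_seq_le_loc.
    exists O. intros n _. rewrite !sum_n_rsum. apply H. }
  assert (H0 : Rbar_le 0 (Lim_seq (sum_n u))).
  { rewrite <- (Lim_seq_const 0). apply Lim_seq_le_loc. exists O. intros n _.
    rewrite sum_n_rsum. apply Rle_trans with (rsum (fun _ => 0) (S n)).
    - clear. induction (S n) as [|k IH]; simpl; lra.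
    - now apply rsum_le. }
  unfold Series. destruct (Lim_seq (sum_n u)); simpl in *; tauto || lra.
Qed.

Lemma majorant_deriv_le f g a b :
  taylor_in_disk a f -> taylor_in_disk b g ->
  quasi_subordinate (fun z => (f z - f (RtoC 0))%C) (fun z => (g z - g (RtoC 0))%C) ->
  forall r : R, 0 <= r <= r0 ->
  majorant_series (deriv_coeff a) r <= majorant_series (deriv_coeff b) r.
Proof.
  intros Ha Hb (Phi & om & HPhi & Hom & Hfg) r Hr.
  destruct (r0_sq r Hr) as [Hr1 _].
  destruct (subordinate_factor Phi om HPhi Hom) as (psi & Hpsi & BPhi & Bpsi & e & He).
  unfold majorant_series, PSeries. apply Series_le_partial.
  - intros n. apply Rmult_le_pos; [apply Cmod_ge_0|apply pow_le; lra].
  - apply (majorant_ex_series b g); auto. lra.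
  - intros N.
    assert (E : forall c, rsum (fun n => Cmod (deriv_coeff c n) * r ^ n) N
                = rsum (fun n => INR (S n) * Cmod (c (S n)) * r ^ n) N).
    { intros c. apply rsum_ext. intros n _. now rewrite Cmod_deriv_coeff. }
    rewrite !E.
    apply (partial_majorant (fun i => a (S i)) (fun i => b (S i)) e); auto; try apply He.
    intros i. apply (subordinate_coeff f g a b Phi om psi e); auto.
    intros j. apply He.
Qed.

(** * Sharpness *)
Lemma is_pseries_C_intro (c : nat -> C) (w l : C) :
  (forall eps, 0 < eps -> exists N, forall n, (N <= n)%nat ->
     Cmod (poly (S n) c w - l)%C < eps) -> is_pseries c w l.
Proof.
  intros H. apply (filterlim_locally_ball_norm (K := C_AbsRing) (U := C_NormedModule)).
  intros [eps He]. destruct (H eps He) as (N & HN). exists N. intros n Hn.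
  rewrite sum_n_poly. exact (HN n Hn).
Qed.

(** A family containing the identity, the disc automorphism
    [(c - z)/(1 - c z)] and its product with [z], by partial fractions; one
    geometric series expands all of them around any point. *)
Definition simple_pole (al be ga : C) (c : R) (z : C) : C :=
  (al + be * z + ga / (1 - RtoC c * z))%C.

Definition pole_coeff (al be ga : C) (c : R) (z0 : C) (k : nat) : C :=
  ((match k with O => al + be * z0 | 1%nat => be | _ => RtoC 0 end)
   + ga / (1 - RtoC c * z0) * (RtoC c / (1 - RtoC c * z0)) ^ k)%C.

(** With [q = 1 - c z0] and [x = c w / q], the sums of the first [n >= 2] terms
    differ from the limit by [ga x^n / (q (1 - x))], as for any geometric
    series. *)
Lemma pole_pseries al be ga c z0 w :
  Cmod (RtoC c * w)%C < Cmod (1 - RtoC c * z0)%C ->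
  is_pseries (pole_coeff al be ga c z0) w (simple_pole al be ga c (z0 + w)%C).
Proof.
  intros Hw. set (q := (1 - RtoC c * z0)%C) in *.
  assert (Hq0 : 0 < Cmod q) by (pose proof (Cmod_ge_0 (RtoC c * w)%C); lra).
  assert (Hq : q <> RtoC 0) by now apply Cmod_gt_0.
  set (x := (RtoC c * w / q)%C).
  assert (Hx : Cmod x < 1).
  { unfold x. rewrite Cmod_div by auto. apply Rmult_lt_reg_r with (Cmod q); auto.
    unfold Rdiv. rewrite Rmult_assoc, Rinv_l by lra. lra. }
  assert (Hx1 : (1 - x)%C <> RtoC 0).
  { intros E. assert (x = RtoC 1) by (replace x with (1 - (1 - x))%C by ring; rewrite E; ring).
    rewrite H, Cmod_1 in Hx. lra. }
  assert (Hqx : (1 - RtoC c * (z0 + w) = q * (1 - x))%C).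
  { unfold x. replace (q * (1 - RtoC c * w / q))%C with (q - RtoC c * w)%C by (field; auto).
    unfold q. ring. }
  set (T := (ga / (q * (1 - x)))%C).
  assert (Hpart : forall n,
    poly (S (S n)) (pole_coeff al be ga c z0) w
    = (simple_pole al be ga c (z0 + w) - T * x ^ S (S n))%C).
  { intros n. unfold simple_pole. rewrite Hqx.
    induction n as [|n IH].
    - simpl. unfold shift, pole_coeff. simpl. fold q. unfold T.
      assert (Hcw : (RtoC c * w = q * x)%C) by (unfold x; field; auto).
      replace (al + be * z0 + ga / q * 1 + w * (be + ga / q * (RtoC c / q * 1) + w * 0))%C
        with (al + be * z0 + be * w + ga / q + ga / q * ((RtoC c * w) / q))%C
        by (field; auto).
      rewrite Hcw. field. split; auto.
    - rewrite poly_last, IH. unfold pole_coeff. fold q.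
      replace (RtoC 0 + ga / q * (RtoC c / q) ^ S (S n))%C
        with (ga / q * (RtoC c / q) ^ S (S n))%C by ring.
      replace (ga / q * (RtoC c / q) ^ S (S n) * w ^ S (S n))%C
        with (ga / q * x ^ S (S n))%C.
      + change (x ^ S (S (S n)))%C with (x * x ^ S (S n))%C.
        unfold T. generalize (x ^ S (S n))%C. intros y. field. split; auto.
      + unfold x. rewrite <- Cmult_assoc, <- Cpow_mult_l. f_equal. f_equal.
        field. auto. }
  apply is_pseries_C_intro. intros eps He.
  assert (HT : 0 < eps / (Cmod T + 1)).
  { apply Rdiv_lt_0_compat; auto. pose proof (Cmod_ge_0 T). lra. }
  pose proof (Cmod_ge_0 T) as HT0.
  destruct (pow_lt_1_zero (Cmod x) ltac:(rewrite Rabs_pos_eq; auto using Cmod_ge_0) _ HT)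
    as (N & HN).
  exists (S N). intros n Hn. destruct n as [|n]; [lia|].
  rewrite Hpart.
  replace (simple_pole al be ga c (z0 + w) - T * x ^ S (S n) - simple_pole al be ga c (z0 + w))%C
    with (- (T * x ^ S (S n)))%C by ring.
  rewrite Cmod_opp, Cmod_mult, Cmod_pow.
  specialize (HN (S (S n)) ltac:(lia)).
  rewrite Rabs_pos_eq in HN by (apply pow_le, Cmod_ge_0).
  assert (0 <= Cmod x ^ S (S n)) by (apply pow_le, Cmod_ge_0).
  assert (Cmod x ^ S (S n) * (Cmod T + 1) < eps).
  { replace eps with (eps / (Cmod T + 1) * (Cmod T + 1)) by (field; lra).
    apply Rmult_lt_compat_r; lra. }
  nra.
Qed.

Lemma pole_denom c z : 0 <= c < 1 -> unit_disk z -> 0 < Cmod (1 - RtoC c * z)%C.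
Proof.
  unfold unit_disk. intros Hc Hz.
  assert (Cmod 1 <= Cmod (1 - RtoC c * z)%C + Cmod (RtoC c * z)%C).
  { replace (RtoC 1) with ((1 - RtoC c * z) + RtoC c * z)%C at 1 by ring.
    apply Cmod_triangle. }
  rewrite Cmod_1, Cmod_mult, Cmod_R, Rabs_pos_eq in H by lra.
  pose proof (Cmod_ge_0 z). nra.
Qed.

Lemma pole_analytic al be ga c : 0 <= c < 1 ->
  analytic_in unit_disk (simple_pole al be ga c).
Proof.
  intros Hc z0 Hz0. exists (pole_coeff al be ga c z0), (Cmod (1 - RtoC c * z0)%C).
  split; [now apply pole_denom|].
  intros w Hw. apply pole_pseries.
  rewrite Cmod_mult, Cmod_R, Rabs_pos_eq by lra. pose proof (Cmod_ge_0 w). nra.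
Qed.

Lemma pole_taylor al be ga c : 0 <= c < 1 ->
  taylor_in_disk (pole_coeff al be ga c (RtoC 0)) (simple_pole al be ga c).
Proof.
  intros Hc z Hz. unfold unit_disk in Hz.
  rewrite <- (Cplus_0_l z) at 2. apply pole_pseries.
  replace (1 - RtoC c * 0)%C with (RtoC 1) by ring.
  rewrite Cmod_mult, Cmod_R, Rabs_pos_eq, Cmod_1 by lra. pose proof (Cmod_ge_0 z). nra.
Qed.

Lemma class_B_of_formula F G : (forall z, unit_disk z -> F z = G z) ->
  analytic_in unit_disk F -> (forall z, unit_disk z -> Cmod (G z) <= 1) -> class_B F.
Proof. intros H HF HG. split; auto. intros z Hz. rewrite H; auto. Qed.

Lemma is_series_single (v : R) :
  is_series (fun n : nat => match n with O => v | _ => 0 end) v.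
Proof.
  apply filterlim_ext with (fun _ : nat => v); [|apply filterlim_const].
  intros n. induction n as [|n IH].
  - now rewrite sum_O.
  - rewrite sum_Sn, <- IH. symmetry. apply Rplus_0_r.
Qed.

(** The Cauchy square of the geometric series. *)
Lemma is_series_arith_geom s : 0 <= s < 1 ->
  is_series (fun n => INR (S n) * s ^ n) (/ (1 - s) * / (1 - s)).
Proof.
  intros Hs.
  assert (Hg : is_series (fun n => s ^ n) (/ (1 - s)))
    by (apply is_series_geom; rewrite Rabs_pos_eq; lra).
  assert (Ha : ex_series (fun n => Rabs (s ^ n))).
  { exists (/ (1 - s)). apply is_series_ext with (2 := Hg).
    intros n. rewrite Rabs_pos_eq; auto. apply pow_le; lra. }
  apply is_series_ext with (2 := is_series_mult _ _ _ _ Hg Hg Ha Ha).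
  intros n. rewrite (sum_eq _ (fun _ => s ^ n)).
  - rewrite sum_cte. apply Rmult_comm.
  - intros k Hk. rewrite <- pow_add. f_equal. lia.
Qed.

Lemma Cdiv_one a : (a / 1)%C = a.
Proof. field. Qed.

(** The function here is [z (c - z)/(1 - c z)], whose coefficients are [c] in
    degree 1 and [- (1 - c^2) c^(k-2)] in degree [k >= 2]. *)
Lemma extremal_majorant c r : 0 < c < 1 -> 0 <= r < 1 ->
  majorant_series (deriv_coeff (pole_coeff (RtoC ((1 - c ^ 2) / c ^ 2)) (RtoC (/ c))
    (RtoC (- ((1 - c ^ 2) / c ^ 2))) c (RtoC 0))) r
  = c + (1 - c ^ 2) / c * (/ (1 - c * r) ^ 2 - 1).
Proof.
  intros Hc Hr. unfold majorant_series, PSeries.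
  set (mu := (1 - c ^ 2) / c).
  assert (Hmu : 0 <= mu).
  { unfold mu. apply Rmult_le_pos; [nra|]. apply Rlt_le, Rinv_0_lt_compat; lra. }
  assert (Hs : 0 <= c * r < 1) by nra.
  apply is_series_unique.
  replace (c + mu * (/ (1 - c * r) ^ 2 - 1))
    with (plus (scal mu (/ (1 - c * r) * / (1 - c * r))) (c - mu))
    by (unfold plus, scal; simpl; unfold mult; simpl; field; lra).
  assert (H := is_series_plus _ _ _ _ (is_series_scal mu _ _ (is_series_arith_geom _ Hs))
    (is_series_single (c - mu))).
  apply is_series_ext with (2 := H). intros n.
  rewrite Cmod_deriv_coeff. unfold pole_coeff.
  replace (1 - RtoC c * 0)%C with (RtoC 1) by ring.
  rewrite Cdiv_one, Cdiv_one.
  match goal with |- _ = ?rhs =>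
    change (mu * (INR (S n) * (c * r) ^ n) + match n with O => c - mu | _ => 0 end = rhs)
  end.
  destruct n as [|n].
  - rewrite Cpow_1_r, <- RtoC_mult, <- RtoC_plus, Cmod_R.
    replace (/ c + - ((1 - c ^ 2) / c ^ 2) * c) with c by (field; lra).
    rewrite Rabs_pos_eq by lra. simpl. ring.
  - rewrite Cplus_0_l, <- RtoC_pow, <- RtoC_mult, Cmod_R, Ropp_mult_distr_l_reverse,
      Rabs_Ropp, Rabs_pos_eq.
    + rewrite Rpow_mult_distr. unfold mu. rewrite Rplus_0_r.
      change (c ^ S (S n)) with (c * c ^ S n).
      generalize (c ^ S n) (r ^ S n). intros. field. lra.
    + apply Rmult_le_pos; [|apply pow_le; lra].
      replace ((1 - c ^ 2) / c ^ 2) with (mu * / c) by (unfold mu; field; lra).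
      apply Rmult_le_pos; auto. apply Rlt_le, Rinv_0_lt_compat; lra.
Qed.

Lemma identity_majorant c r :
  majorant_series (deriv_coeff (pole_coeff 0 1 0 c (RtoC 0))) r = 1.
Proof.
  unfold majorant_series, PSeries. apply is_series_unique.
  apply is_series_ext with (2 := is_series_single 1). intros n.
  rewrite Cmod_deriv_coeff. unfold pole_coeff.
  replace (RtoC 0 / (1 - RtoC c * 0))%C with (RtoC 0)
    by (replace (1 - RtoC c * 0)%C with (RtoC 1) by ring; rewrite Cdiv_one; reflexivity).
  rewrite Cmult_0_l, Cplus_0_r. destruct n as [|n].
  - rewrite Cmod_1. simpl. now rewrite !Rmult_1_r.
  - now rewrite Cmod_0, Rmult_0_r, Rmult_0_l.
Qed.

(** For [f z = z (c - z)/(1 - c z)] and [g z = z] the inequality at [r] reads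
    [c + ((1 - c^2)/c) (1/(1 - c r)^2 - 1) <= 1].  If [c r > r0], the last factor
    exceeds 1/2, and the left side exceeds [c + (1 - c^2)/(2 c) > 1].  So any [c]
    between [r0 / rho] and 1 works at [r = rho]; the midpoint is taken. *)
Lemma sharpness rho : r0 < rho < 1 ->
     exists (f g : C -> C) (a b : nat -> C),
       analytic_in unit_disk f /\ analytic_in unit_disk g /\
       taylor_in_disk a f /\ taylor_in_disk b g /\
       quasi_subordinate (fun z => (f z - f (RtoC 0))%C)
                         (fun z => (g z - g (RtoC 0))%C) /\
       exists r : R, r0 < r <= rho /\
         ~ (majorant_series (deriv_coeff a) r <= majorant_series (deriv_coeff b) r).
Proof.
  intros Hrho.
  assert (Hr0 : 0 < r0 /\ (1 - r0) ^ 2 = 2 / 3).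
  { unfold r0. pose proof (sqrt_pos (2 / 3)). pose proof (sqrt_sqrt (2 / 3) ltac:(lra)).
    split; nra. }
  destruct Hr0 as [Hr0 Hr0sq].
  set (c := (r0 / rho + 1) / 2).
  assert (Hq : 0 < r0 / rho < 1).
  { split; [apply Rdiv_lt_0_compat; lra|].
    apply Rmult_lt_reg_r with rho; [lra|].
    unfold Rdiv. rewrite Rmult_assoc, Rinv_l by lra. lra. }
  assert (Hc : 0 < c < 1) by (unfold c; lra).
  assert (Hcr : r0 < c * rho).
  { replace (c * rho) with ((r0 + rho) / 2) by (unfold c; field; lra). lra. }
  set (mu := (1 - c ^ 2) / c ^ 2).
  exists (simple_pole (RtoC mu) (RtoC (/ c)) (RtoC (- mu)) c), (simple_pole 0 1 0 c).
  exists (pole_coeff (RtoC mu) (RtoC (/ c)) (RtoC (- mu)) c (RtoC 0)),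
    (pole_coeff 0 1 0 c (RtoC 0)).
  split; [apply pole_analytic; lra|]. split; [apply pole_analytic; lra|].
  split; [apply pole_taylor; lra|]. split; [apply pole_taylor; lra|].
  assert (Hc0 : RtoC c <> RtoC 0) by (intros E; apply RtoC_inj in E; lra).
  assert (Hid : forall z, unit_disk z -> simple_pole 0 1 0 c z = z).
  { intros z Hz. unfold simple_pole.
    pose proof (proj2 (Cmod_gt_0 _) (pole_denom c z ltac:(lra) Hz)). field. auto. }
  assert (H0 : unit_disk (RtoC 0)) by (unfold unit_disk; rewrite Cmod_0; lra).
  split.
  - exists (simple_pole (RtoC (/ c)) 0 (RtoC (- ((1 - c ^ 2) / c))) c), (simple_pole 0 1 0 c).
    assert (Hphi : forall z, unit_disk z ->
      simple_pole (RtoC (/ c)) 0 (RtoC (- ((1 - c ^ 2) / c))) c z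
      = ((RtoC c - z) / (1 - RtoC c * z))%C).
    { intros z Hz. unfold simple_pole.
      pose proof (proj2 (Cmod_gt_0 _) (pole_denom c z ltac:(lra) Hz)).
      rewrite RtoC_opp, RtoC_div, RtoC_minus, RtoC_pow, RtoC_inv by (try apply pow_nonzero; lra).
      field. split; auto. }
    split; [|split].
    + apply class_B_of_formula with (1 := Hphi); [apply pole_analytic; lra|].
      intros z Hz. pose proof (pole_denom c z ltac:(lra) Hz) as Hd.
      rewrite Cmod_div by (now apply Cmod_gt_0).
      apply Rmult_le_reg_r with (Cmod (1 - RtoC c * z)%C); auto.
      unfold Rdiv. rewrite Rmult_assoc, Rinv_l, Rmult_1_r, Rmult_1_l by lra.
      replace (RtoC c - z)%C with (- (z - RtoC c))%C by ring. rewrite Cmod_opp.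
      replace (RtoC c) with (Cconj (RtoC c)) at 2
        by (apply injective_projections; simpl; ring).
      apply schwarz_pick; [unfold unit_disk in Hz; lra|].
      rewrite Cmod_R, Rabs_pos_eq; lra.
    + split; [|now apply Hid].
      apply class_B_of_formula with (1 := Hid); [apply pole_analytic; lra|].
      intros z Hz. unfold unit_disk in Hz. lra.
    + intros z Hz. rewrite (Hid z Hz), (Hid z Hz), (Hid _ H0), (Hphi z Hz).
      unfold simple_pole, mu.
      pose proof (proj2 (Cmod_gt_0 _) (pole_denom c z ltac:(lra) Hz)).
      rewrite RtoC_opp, RtoC_div, RtoC_minus, RtoC_pow, RtoC_inv by (try apply pow_nonzero; lra).
      field. repeat split; auto.
  - exists rho. split; [lra|]. unfold mu.
    rewrite extremal_majorant, identity_majorant by lra. apply Rlt_not_le.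
    set (s := c * rho) in *.
    assert (Hs : s < 1) by (unfold s; nra).
    assert (Hs2 : 0 < (1 - s) ^ 2 < 2 / 3) by (split; [apply pow_lt; lra|nra]).
    assert (Hinv : 3 / 2 < / (1 - s) ^ 2).
    { replace (3 / 2) with (/ (2 / 3)) by field. apply Rinv_lt_contravar; [|lra].
      apply Rmult_lt_0_compat; lra. }
    assert (Hk : 2 * (1 - c) < (1 - c ^ 2) / c).
    { apply Rmult_lt_reg_r with c; [lra|].
      replace ((1 - c ^ 2) / c * c) with (1 - c ^ 2) by (field; lra). nra. }
    nra.
Qed.

Theorem theorem5 :
  (forall (f g : C -> C) (a b : nat -> C),
     analytic_in unit_disk f -> analytic_in unit_disk g ->
     taylor_in_disk a f -> taylor_in_disk b g ->
     quasi_subordinate (fun z => (f z - f (RtoC 0))%C)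
                       (fun z => (g z - g (RtoC 0))%C) ->
     forall r : R, 0 <= r <= r0 ->
       majorant_series (deriv_coeff a) r <= majorant_series (deriv_coeff b) r)
  /\
  (forall rho : R, r0 < rho < 1 ->
     exists (f g : C -> C) (a b : nat -> C),
       analytic_in unit_disk f /\ analytic_in unit_disk g /\
       taylor_in_disk a f /\ taylor_in_disk b g /\
       quasi_subordinate (fun z => (f z - f (RtoC 0))%C)
                         (fun z => (g z - g (RtoC 0))%C) /\
       exists r : R, r0 < r <= rho /\
         ~ (majorant_series (deriv_coeff a) r <= majorant_series (deriv_coeff b) r)).
Proof.
  split.
  - intros f g a b _ _. apply majorant_deriv_le.
  - apply sharpness.
Qed.
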